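(* Let $d\ge 1$, $s\in(d,2d)$, $\beta>0$, let $|\cdot|$ be a norm on $\mathbb{R}^d$, and put $\gamma:=\frac{s}{2d}$ and $\Delta:=\frac{1}{\log_2(1/\gamma)}$. Consider long-range percolation on $\mathbb{Z}^d$ with connection probabilities $p_{x,y}=1-\exp\{-\beta|x-y|^{-s}\}$, and let $D^{\mathrm{dis}}(x,y)$ denote the chemical distance between $x,y\in\mathbb{Z}^d$. Then there are constants $c,C\in(0,\infty)$, depending only on $\beta$, $s$ and the underlying norm $|\cdot|$, such that $$\lim_{|x|\to\infty}P\bigl(c(\log|x|)^\Delta\le D^{\mathrm{dis}}(0,x)\le C(\log|x|)^\Delta\bigr)=1,$$ where $x$ ranges over $\mathbb{Z}^d$.
   Context: Long-range percolation on $\mathbb{Z}^d$ with parameters $\beta>0$ and $s>0$ is the random graph with vertex set $\mathbb{Z}^d$ in which every pair of nearest neighbors (points at $\ell^1$-distance one) is joined by an edge, and, independently of all other edges, every pair of distinct non-neighboring vertices $x,y\in\mathbb{Z}^d$ is joined by an edge with probability $p_{x,y}:=1-\exp\{-\beta|x-y|^{-s}\}$, where $|\cdot|$ is a fixed (arbitrary) norm on $\mathbb{R}^d$. The chemical distance $D^{\mathrm{dis}}(x,y)$ is the graph-theoretical distance, i.e., the minimal number of edges in a path in this graph connecting $x$ to $y$. *)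

(* Defs.v *)
From HB Require Import structures.
From mathcomp Require Import all_boot all_order all_algebra finmap.
From mathcomp Require Import all_classical all_reals all_analysis.
Set Implicit Arguments.
Unset Strict Implicit.
Unset Printing Implicit Defensive.
Import Order.TTheory GRing.Theory Num.Theory numFieldNormedType.Exports.
Local Open Scope classical_set_scope.
Local Open Scope ring_scope.

(* The canonical norm `|x| on 'rV[R]_d is the sup norm, so an arbitrary norm on
   R^d is a function.  Nonnegativity follows from the three axioms. *)
Record is_norm (R : realType) (d : nat) (N : 'rV[R]_d -> R) : Prop := IsNorm {
  norm_triangle : forall x y, N (x + y) <= N x + N y ;
  norm_scale : forall (a : R) x, N (a *: x) = `|a| * N x ;
  norm_definite : forall x, N x = 0 -> x = 0 }.

Definition embedZ (R : realType) (d : nat) (x : 'rV[int]_d) : 'rV[R]_d :=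
  map_mx intr x.

Definition nearest_neighbor (d : nat) (x y : 'rV[int]_d) : bool :=
  \sum_(i < d) `|x 0 i - y 0 i| == 1.

(* The filter |x| -> oo on Z^d. *)
Definition norm_infty (R : realType) (d : nat) (N : 'rV[R]_d -> R) :
    set_system 'rV[int]_d :=
  filter_from [set: R] (fun M => [set x | M < N (embedZ R x)]).

Instance norm_infty_filter (R : realType) (d : nat) (N : 'rV[R]_d -> R) :
  Filter (norm_infty N).
Proof.
apply: filter_from_filter; first by exists 0.
move=> M1 M2 _ _; exists (Num.max M1 M2) => // x /=.
by rewrite gt_max => /andP[].
Qed.

(* The product rule is required of every finite subfamily of (A i)_(i in D). *)
Definition mutually_independent (R : realType) (disp : measure_display)
    (T : measurableType disp) (P : probability T R) (I : choiceType)
    (D : set I) (A : I -> set T) : Prop :=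
  forall J : {fset I}, [set` J] `<=` D ->
    P (\bigcap_(i in [set` J]) A i) = (\prod_(i <- J) P (A i))%E.

(* A simple graph on V is given by its edge set, a set of two-element subsets
   of V. *)
Definition simple_graph (V : choiceType) (E : set {fset V}) : Prop :=
  forall e, E e -> #|` e| = 2%N.

Definition adjacent (V : choiceType) (E : set {fset V}) (x y : V) : bool :=
  [fset x; y]%fset \in E.

(* The value is +oo when no path joins x to y. *)
Definition graph_dist (R : realType) (V : choiceType) (E : set {fset V})
    (x y : V) : \bar R :=
  ereal_inf [set (size p)%:R%:E
            | p in [set p : seq V | path (adjacent E) x p /\ last x p = y]].

Definition connection_prob (R : realType) (d : nat) (N : 'rV[R]_d -> R)
    (beta s : R) (x y : 'rV[int]_d) : R :=
  1 - expR (- (beta * N (embedZ R x - embedZ R y) `^ (- s))).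

(* G w is the edge set of the random graph at the sample point w. *)
Record long_range_percolation (R : realType) (d : nat) (N : 'rV[R]_d -> R)
    (beta s : R) (disp : measure_display) (T : measurableType disp)
    (P : probability T R) (G : T -> set {fset 'rV[int]_d}) : Prop :=
  LongRangePercolation {
  lrp_simple : forall w, simple_graph (G w) ;
  lrp_measurable : forall e, measurable [set w | G w e] ;
  lrp_nearest : forall w x y, nearest_neighbor x y -> G w [fset x; y]%fset ;
  lrp_prob : forall x y, x != y -> ~~ nearest_neighbor x y ->
    P [set w | G w [fset x; y]%fset] = (connection_prob N beta s x y)%:E ;
  lrp_independent :
    mutually_independent P [set e : {fset 'rV[int]_d} | #|` e| = 2%N]
      (fun e => [set w | G w e]) }.

Definition lrp_gamma (R : realType) (d : nat) (s : R) : R := s / (2 * d%:R).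

Definition log2 (R : realType) (x : R) : R := ln x / ln 2.

Definition lrp_Delta (R : realType) (d : nat) (s : R) : R :=
  1 / log2 (1 / lrp_gamma d s).

(* Main.v *)
Require Import Defs.
From HB Require Import structures.
From mathcomp Require Import all_boot all_order all_algebra finmap.
From mathcomp Require Import all_classical all_reals all_analysis.
From mathcomp Require Import zify ring lra.
Set Implicit Arguments.
Unset Strict Implicit.
Unset Printing Implicit Defensive.
Import Order.TTheory GRing.Theory Num.Theory numFieldNormedType.Exports.
Local Open Scope classical_set_scope.
Local Open Scope ring_scope.

(** Why the distance is of order (log |x|)^Delta.

   Upper bound.  An edge between points at distance r is present with
   probability of order r^(-s).  The balls of radius m around the two endpoints
   of a gap of length r contain m^(2d) pairs of points, so once m is a little
   larger than r^gamma, with gamma = s / (2d), some pair is joined by an edge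
   with overwhelming probability; the gap of length r is then replaced by one
   edge and two gaps of length at most m.  After k rounds there are 2^k gaps of
   length about r^(gamma^k), and these are bounded when 2^k is of order
   (log r)^Delta, because gamma^Delta = 1/2.  When no such edge exists, the gap
   is crossed by nearest-neighbour steps.  Since short gaps fail with a
   probability that is not small, the failures have to be averaged: the
   induction over scales ([hop_moment_step], [hop_moment_bound]) bounds the
   exponential moment, with rate la = ln L / L, of the distance capped at L.
   The two new gaps depend on disjoint sets of edges, so their moments multiply
   ([Ebern_two_gaps]).  The rate is small enough for a failure to cost only
   O(la), yet with L a multiple of (log r)^Delta it makes the Markov inequality
   give a probability at most L^(-1/2), which tends to 0.

   Lower bound.  A path of n edges from x to y has an edge of length at least
   |x - y| / n.  By the van den Berg-Kesten inequality [BK_inequality] the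
   probability that y is within n steps of x is at most a constant times
   (n / |x - y|)^s sum_(a + b = n - 1) S_a S_b, where S_a bounds the expected
   number of points within a steps ([reach_prob_step]).  Summing the
   minimum of 1 and this bound over y gives S_n <= C (n^s sum S_a S_b)^(d / s)
   ([layer_sum]), and this recursion has solutions S_n = exp (O(n^(1 / Delta)))
   ([growth_function]), because 2 (n / 2)^(1 / Delta) = (s / d) n^(1 / Delta).
   For n = c (log |x|)^Delta with c small, the probability is at most a negative
   power of |x| ([reach_prob_le]).

   Both arguments concern finitely many edges at a time, and are carried out
   for an explicit expectation [Ebern] over independent Bernoulli edges;
   [prob_cfg] identifies it with the given probability. *)

(** * Independent edges and the van den Berg-Kesten inequality *)

Section BernoulliExpectation.
Variables (R : realType) (I : choiceType) (p : I -> R).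

(** The expectation of [F] at the random set that contains each entry [e] of
    [es] independently with probability [p e].  Revealing the entries one by one
    reduces the van den Berg-Kesten inequality and the link with a probability
    space to inductions on [es]. *)
Fixpoint Ebern (es : seq I) (F : set I -> R) : R :=
  if es is e :: es' then
    p e * Ebern es' (fun w => F (e |` w)) + (1 - p e) * Ebern es' F
  else F set0.

Definition indic (Q : Prop) : R := (`[< Q >])%:R.

Hypothesis p01 : forall e, 0 <= p e <= 1.

Let p0 e : 0 <= p e. Proof. by case/andP: (p01 e). Qed.
Let q0 e : 0 <= 1 - p e. Proof. by rewrite subr_ge0; case/andP: (p01 e). Qed.

Lemma indic01 Q : 0 <= indic Q <= 1.
Proof. by rewrite /indic; case: asbool; rewrite ?ler01 ?lexx. Qed.

Lemma indicT (Q : Prop) : Q -> indic Q = 1.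
Proof. by move=> q; rewrite /indic asboolT. Qed.

Lemma indicF (Q : Prop) : ~ Q -> indic Q = 0.
Proof. by move=> q; rewrite /indic asboolF. Qed.

Lemma indic_le (Q Q' : Prop) : (Q -> Q') -> indic Q <= indic Q'.
Proof.
move=> QQ'; have [q|q] := pselect Q; first by rewrite !indicT//; exact: QQ'.
by rewrite (indicF q); case/andP: (indic01 Q').
Qed.

Lemma indic_eq (Q Q' : Prop) : (Q <-> Q') -> indic Q = indic Q'.
Proof. by move=> /propext ->. Qed.

Lemma Ebern_le es F G : (forall w, w `<=` [set` es] -> F w <= G w) ->
  Ebern es F <= Ebern es G.
Proof.
elim: es F G => [|e es IH] F G FG /=; first exact: FG.
apply: lerD; apply: ler_wpM2l => //; apply: IH => w wes; apply: FG.
  by move=> x /= [->|/wes xe]; rewrite in_cons ?eqxx//; apply/orP; right.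
by move=> x /wes xe /=; rewrite in_cons; apply/orP; right.
Qed.

Lemma Ebern_ext es F G : (forall w, w `<=` [set` es] -> F w = G w) ->
  Ebern es F = Ebern es G.
Proof.
move=> FG; apply/eqP; rewrite eq_le; apply/andP; split; apply: Ebern_le => w /FG.
  by move=> ->.
by move=> ->.
Qed.

Lemma EbernD es F G : Ebern es (fun w => F w + G w) = Ebern es F + Ebern es G.
Proof.
elim: es F G => [//|e es IH] F G /=.
by rewrite (IH (fun w => F (e |` w))) IH; ring.
Qed.

Lemma EbernZ es c F : Ebern es (fun w => c * F w) = c * Ebern es F.
Proof.
elim: es F => [//|e es IH] F /=.
by rewrite (IH (fun w => F (e |` w))) IH; ring.
Qed.

Lemma Ebern_cst es c : Ebern es (fun=> c) = c.
Proof. by elim: es => [//|e es IH] /=; rewrite IH; ring. Qed.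

Lemma Ebern_ge0 es F : (forall w, w `<=` [set` es] -> 0 <= F w) -> 0 <= Ebern es F.
Proof. by move=> F0; rewrite -(Ebern_cst es 0); exact: Ebern_le. Qed.

Lemma Ebern_sum (J : eqType) es (s : seq J) (F : J -> set I -> R) :
  Ebern es (fun w => \sum_(j <- s) F j w) = \sum_(j <- s) Ebern es (F j).
Proof.
elim: s => [|j s IH].
  rewrite big_nil -[RHS](Ebern_cst es).
  by apply: Ebern_ext => w _; rewrite big_nil.
rewrite big_cons -IH -EbernD; apply: Ebern_ext => w _.
by rewrite big_cons.
Qed.

(** Independence of disjoint sets of edges, in the form of Fubini. *)
Lemma Ebern_cat s t F :
  Ebern (s ++ t) F = Ebern s (fun w => Ebern t (fun w' => F (w `|` w'))).
Proof.
elim: s F => [|e s IH] F /=.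
  by apply: Ebern_ext => w _; rewrite set0U.
by rewrite !IH; congr (_ * _ + _); apply: Ebern_ext => w _; apply: Ebern_ext => w' _;
  rewrite setUA.
Qed.

Lemma Ebern_mid e s t F : Ebern (s ++ e :: t) F = Ebern (e :: s ++ t) F.
Proof.
elim: s F => [//|f s IH] F.
rewrite !cat_cons [LHS]/= !IH /=.
have -> : (fun w => F (f |` (e |` w))) = (fun w => F (e |` (f |` w))).
  by apply/funext => w; rewrite setUCA.
ring.
Qed.

Lemma Ebern_perm s t F : perm_eq s t -> Ebern s F = Ebern t F.
Proof.
elim: s t F => [|e s IH] t F.
  by rewrite perm_sym => /perm_size /size0nil ->.
move=> st; have et : e \in t by rewrite -(perm_mem st) mem_head.
case/splitPr: et st => t1 t2 st; rewrite Ebern_mid /=.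
have st' : perm_eq s (t1 ++ t2).
  by rewrite -(perm_cons e) (perm_trans st)// perm_catC /= perm_cons perm_catC.
by rewrite !(IH _ _ st').
Qed.

Lemma Ebern_mem e es : uniq es -> Ebern es (fun w => indic (w e)) <= p e.
Proof.
have [ees|ees _] := boolP (e \in es); last first.
  rewrite (_ : Ebern _ _ = Ebern es (fun=> 0)); first by rewrite Ebern_cst.
  by apply: Ebern_ext => w wst; rewrite indicF// => /wst; exact/negP.
case/splitPr: ees => s t; rewrite -(cat1s e t).
rewrite uniq_catCA cat1s Ebern_mid /= => /andP[/negP est _].
rewrite [X in _ + _ * X](_ : _ = 0) ?mulr0 ?addr0; last first.
  rewrite -[RHS](Ebern_cst (s ++ t)).
  by apply: Ebern_ext => w wst; rewrite indicF// => /wst.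
rewrite ler_piMr//; apply: le_trans (_ : Ebern (s ++ t) (fun=> 1) <= _); last first.
  by rewrite Ebern_cst.
by apply: Ebern_le => w _; case/andP: (indic01 ((e |` w) e)).
Qed.

(** Two occurrences with disjoint witnesses.  The witnesses range over an
    arbitrary set of pairs, rather than over a product of two families: the
    induction in [BK_inequality] leaves the class of products. *)
Definition disj_occ (PP : set (set I * set I)) (w : set I) : Prop :=
  exists2 AB, PP AB & [/\ AB.1 `&` AB.2 = set0, AB.1 `<=` w & AB.2 `<=` w].
Definition indep_occ (PP : set (set I * set I)) (w w' : set I) : Prop :=
  exists2 AB, PP AB & AB.1 `<=` w /\ AB.2 `<=` w'.

(** The disjointness of the witnesses is traded for the use of two independent
    configurations.  Reveal the first edge [e], open with probability [P].  In
    one configuration, [e] may serve only one of the two witnesses; let [PA] and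
    [PB] be the pairs left when it is removed from the first or from the second
    one, and [PN] the pairs that avoid it.  By induction the left side is at most
    P X(PA u PB) + (1 - P) X(PN), while the right side is at least
    P^2 X(PA u PB) + P (1 - P) (X(PA) + X(PB)) + (1 - P)^2 X(PN).  The difference
    is P (1 - P) times X(PA) + X(PB) - X(PA u PB) - X(PN), which is nonnegative
    because an occurrence of [PN] is one of both [PA] and [PB]. *)
Lemma BK_inequality es (PP : set (set I * set I)) : uniq es ->
  Ebern es (fun w => indic (disj_occ PP w)) <=
  Ebern es (fun w => Ebern es (fun w' => indic (indep_occ PP w w'))).
Proof.
elim: es PP => [|e es IH] PP /=.
  move=> _; apply: indic_le => -[AB PAB [_ A B]]; by exists AB.
case/andP => /negP ees ues.
pose PN := [set AB | PP AB /\ ~ AB.1 e /\ ~ AB.2 e].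
pose PA := [set AB : set I * set I | exists A B, [/\ PP (A, B), ~ B e & AB = (A `\ e, B)]].
pose PB := [set AB : set I * set I | exists A B, [/\ PP (A, B), ~ A e & AB = (A, B `\ e)]].
pose X Q := Ebern es (fun w => Ebern es (fun w' => indic (indep_occ Q w w'))).
have sD (A w : set I) : A `<=` e |` w -> A `\ e `<=` w.
  by move=> Aw x [/Aw [/= ->|]] //; case.
have sN (A w : set I) : A `<=` e |` w -> ~ A e -> A `<=` w.
  by move=> Aw Ae x Ax; case: (Aw _ Ax) => // xe; rewrite xe in Ax.
have Dm (A w : set I) : A `\ e `<=` w -> A `<=` e |` w.
  by move=> Aw x Ax; have [->|xe] := pselect (x = e); [left|right; apply: Aw].
have h1 : Ebern es (fun w => indic (disj_occ PP (e |` w))) <= X (PA `|` PB).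
  apply: le_trans (IH _ ues); apply: Ebern_le => w _; apply: indic_le.
  move=> -[[A B] PAB /= [AB0 Aw Bw]].
  have [Ae|Ae] := pselect (A e).
    have Be : ~ B e by move=> Be; have : (A `&` B) e by []; rewrite AB0.
    exists (A `\ e, B); first by left; exists A, B.
    split => /=; [|exact: sD|exact: sN].
    by apply/seteqP; split => // x [[Ax _] Bx]; rewrite -AB0; split.
  exists (A, B `\ e); first by right; exists A, B.
  split => /=; [|exact: sN|exact: sD].
  by apply/seteqP; split => // x [Ax [Bx _]]; rewrite -AB0; split.
have h2 : Ebern es (fun w => indic (disj_occ PP w)) <= X PN.
  apply: le_trans (IH _ ues); apply: Ebern_le => w wes; apply: indic_le.
  move=> -[[A B] PAB /= [AB0 Aw Bw]]; exists (A, B) => //=.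
  by split => //; split => [/Aw/wes|/Bw/wes]; exact: ees.
have h3 : X (PA `|` PB) + X PN <= X PA + X PB.
  rewrite -!EbernD; apply: Ebern_le => w _; rewrite -!EbernD; apply: Ebern_le => w' _.
  have [[[A B] [PAB [/= Ae Be]] [/= Aw Bw]]|nN] := pselect (indep_occ PN w w').
    rewrite (@indicT (indep_occ PA w w')); last first.
      exists (A `\ e, B); first by exists A, B.
      by split => //= x [/Aw].
    rewrite (@indicT (indep_occ PB w w')); last first.
      exists (A, B `\ e); first by exists A, B.
      by split => //= x [/Bw].
    by apply: lerD; [case/andP: (indic01 (indep_occ (PA `|` PB) w w'))
      |case/andP: (indic01 (indep_occ PN w w'))].
  rewrite (indicF nN) addr0.
  have [[AB [ABm|ABm] ABw]|nN'] := pselect (indep_occ (PA `|` PB) w w').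
  - rewrite (@indicT (indep_occ PA w w')); last by exists AB.
    apply: (@le_trans _ _ 1); first by case/andP: (indic01 (indep_occ (PA `|` PB) w w')).
    by rewrite lerDl; case/andP: (indic01 (indep_occ PB w w')).
  - rewrite (@indicT (indep_occ PB w w')); last by exists AB.
    apply: (@le_trans _ _ 1); first by case/andP: (indic01 (indep_occ (PA `|` PB) w w')).
    by rewrite lerDr; case/andP: (indic01 (indep_occ PA w w')).
  - by rewrite (indicF nN') addr_ge0.
have EbernZD F G (a b : R) :
    Ebern es (fun w => a * F w + b * G w) = a * Ebern es F + b * Ebern es G.
  by rewrite EbernD !EbernZ.
rewrite !EbernZD.
pose Z (f g : set I -> set I) :=
  Ebern es (fun w => Ebern es (fun w' => indic (indep_occ PP (f w) (g w')))).
pose c := (fun w => e |` w).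
rewrite -[X in _ <= p e * (p e * X + _) + _]/(Z c c).
rewrite -[X in _ <= p e * (_ + _ * X) + _]/(Z c id).
rewrite -[X in _ <= _ + (1 - p e) * (p e * X + _)]/(Z id c).
rewrite -[X in _ <= _ + (1 - p e) * (_ + _ * X)]/(Z id id).
have z11 : X (PA `|` PB) <= Z c c.
  apply: Ebern_le => w _; apply: Ebern_le => w' _; apply: indic_le => -[AB].
  move=> [[A [B [PAB _ ->]]]|[A [B [PAB _ ->]]]] /= [Aw Bw]; exists (A, B) => //=;
    split; try exact: Dm.
    by move=> x /Bw; right.
  by move=> x /Aw; right.
have z10 : X PA <= Z c id.
  apply: Ebern_le => w _; apply: Ebern_le => w' _; apply: indic_le => -[AB].
  by move=> [A [B [PAB _ ->]]] /= [Aw Bw]; exists (A, B) => //=; split=> //; exact: Dm.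
have z01 : X PB <= Z id c.
  apply: Ebern_le => w _; apply: Ebern_le => w' _; apply: indic_le => -[AB].
  by move=> [A [B [PAB _ ->]]] /= [Aw Bw]; exists (A, B) => //=; split=> //; exact: Dm.
have z00 : X PN <= Z id id.
  apply: Ebern_le => w _; apply: Ebern_le => w' _; apply: indic_le => -[AB].
  by move=> [PAB _] ABw; exists AB.
have := p0 e; have := q0 e; set P := p e; set Q := 1 - P => Q0 P0.
have PQ : P + Q = 1 by rewrite /Q addrC subrK.
apply: (@le_trans _ _ (P * X (PA `|` PB) + Q * X PN)).
  by apply: lerD; apply: ler_wpM2l.
apply: (@le_trans _ _ (P * (P * X (PA `|` PB) + Q * X PA) +
    Q * (P * X PB + Q * X PN))); last first.
  by apply: lerD; apply: ler_wpM2l => //; apply: lerD; apply: ler_wpM2l.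
have PQ0 : 0 <= P * Q by exact: mulr_ge0.
have := ler_wpM2l PQ0 h3.
have -> : Q = 1 - P by [].
move: (X (PA `|` PB)) (X PN) (X PA) (X PB) => a b u v h; lra.
Qed.
End BernoulliExpectation.

(** * From a probability space to finitely many Bernoulli edges *)

Section Transfer.
Context (R : realType) (disp : measure_display) (T : measurableType disp)
  (P : probability T R) (I : choiceType) (D : set I) (A : I -> set T).
Hypothesis mA : forall e, measurable (A e).
Hypothesis indepA : mutually_independent P D A.

Let p e := fine (P (A e)).

Let pE e : P (A e) = (p e)%:E.
Proof. by rewrite /p fineK// fin_num_measure. Qed.

Let cfg_cons e es (Q : set I -> Prop) :
  [set w | Q [set f | A f w /\ f \in e :: es]] =
  (A e `&` [set w | Q (e |` [set f | A f w /\ f \in es])]) `|`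
  (~` A e `&` [set w | Q [set f | A f w /\ f \in es]]).
Proof.
have splitA w : A e w ->
    [set f | A f w /\ f \in e :: es] = e |` [set f | A f w /\ f \in es].
  move=> Aew; apply/seteqP; split => x /=; rewrite in_cons.
    by move=> [Ax /orP[/eqP ->|]]; [left|right].
  by move=> [->|[Ax xe]]; [rewrite eqxx|rewrite xe orbT].
have splitN w : ~ A e w ->
    [set f | A f w /\ f \in e :: es] = [set f | A f w /\ f \in es].
  move=> Aew; apply/seteqP; split => x /=; rewrite in_cons.
    by move=> [Ax /orP[/eqP xe|//]]; rewrite xe in Ax.
  by move=> [Ax ->]; rewrite orbT.
apply/seteqP; split => w /=.
  by have [Aew|Aew] := pselect (A e w); [rewrite splitA//; left|rewrite splitN//; right].
by move=> [[Aew]|[Aew]]; [rewrite splitA|rewrite splitN].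
Qed.

Lemma measurable_cfg (es : seq I) (Q : set I -> Prop) :
  measurable [set w | Q [set e | A e w /\ e \in es]].
Proof.
elim: es Q => [|e es IH] Q.
  have [q|q] := pselect (Q set0).
    rewrite (_ : [set _ | _] = setT)//; apply/seteqP; split => // w _ /=.
    by rewrite (_ : [set _ | _] = set0)//; apply/seteqP; split => // x [].
  rewrite (_ : [set _ | _] = set0)//; apply/seteqP; split => // w /=.
  by rewrite (_ : [set _ | _] = set0)//; apply/seteqP; split => // x [].
rewrite cfg_cons; apply: measurableU; apply: measurableI => //.
- exact: (IH (fun w => Q (e |` w))).
- exact: measurableC.
Qed.

(** Independence is given for events that say that edges are open.  Hence the
    induction carries a set [J] of edges known to be open; the case that the
    next edge is closed is obtained by subtracting the case that it is open. *)
Lemma prob_cfg_cond (es : seq I) (J : {fset I}) (Q : set I -> Prop) :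
  uniq es -> [set` es] `<=` D -> [set` J] `<=` D ->
  (forall e, e \in es -> e \notin J) ->
  P ((\bigcap_(i in [set` J]) A i) `&` [set w | Q [set e | A e w /\ e \in es]]) =
  ((\prod_(i <- J) p i) * Ebern p es (fun w => indic R (Q w)))%:E.
Proof.
elim: es J Q => [|e es IH] J Q.
  move=> _ _ JD _ /=.
  have PJ : P (\bigcap_(i in [set` J]) A i) = (\prod_(i <- J) p i)%:E.
    by rewrite indepA// (eq_bigr (fun i => (p i)%:E)) ?prodEFin.
  have e0 w : [set e : I | A e w /\ e \in [::]] = set0.
    by apply/seteqP; split => // x [].
  have [q|q] := pselect (Q set0).
    rewrite indicT// mulr1 -PJ; congr (P _).
    by apply/seteqP; split => w; [case|split => //=; rewrite e0].
  rewrite indicF// mulr0.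
  rewrite (_ : [set w | Q [set e | A e w /\ e \in [::]]] = set0) ?setI0 ?measure0//.
  by apply/seteqP; split => w //=; rewrite e0.
rewrite cons_uniq => /andP[ees ues] esD JD esJ.
have esD' : [set` es] `<=` D.
  by move=> x xe; apply: esD => /=; rewrite in_cons xe orbT.
have De : D e by apply: esD => /=; rewrite mem_head.
have eJ : e \notin J by apply: esJ; rewrite mem_head.
have esJ' f : f \in es -> f \notin J by move=> fe; apply: esJ; rewrite in_cons fe orbT.
have JeD : [set` (e |` J)%fset] `<=` D.
  by move=> x /=; rewrite in_fset1U => /orP[/eqP ->//|]; apply: JD.
have esJe f : f \in es -> f \notin (e |` J)%fset.
  move=> fe; rewrite in_fset1U negb_or esJ'// andbT.
  by apply: contraNneq ees => <-.
have capJe : \bigcap_(i in [set` (e |` J)%fset]) A i = A e `&` \bigcap_(i in [set` J]) A i.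
  apply/seteqP; split => w /=.
    by move=> h; split => [|i iJ]; apply: h; rewrite /= in_fset1U ?eqxx// iJ orbT.
  by move=> [Aw h] i /=; rewrite in_fset1U => /orP[/eqP ->//|]; apply: h.
set B := \bigcap_(i in [set` J]) A i in capJe *.
have mB : measurable B.
  apply: fin_bigcap_measurable => //; exact: finite_fset.
set X1 := [set w | Q (e |` [set f | A f w /\ f \in es])].
set X0 := [set w | Q [set f | A f w /\ f \in es]].
have mX1 : measurable X1 := measurable_cfg es (fun w => Q (e |` w)).
have mX0 : measurable X0 := measurable_cfg es Q.
rewrite cfg_cons -/X1 -/X0 setIUr measureU; first last.
- by apply/seteqP; split => // w [[_ [Aw _]] [_ [nAw _]]].
- by apply: measurableI => //; apply: measurableI => //; exact: measurableC.
- by apply: measurableI => //; apply: measurableI.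
have -> : B `&` (~` A e `&` X0) = (B `&` X0) `\` (A e `&` B `&` X0).
  apply/seteqP; split => w /=.
    by move=> [Bw [nAw X0w]]; split=> // -[[]].
  by move=> [[Bw X0w] h]; split => //; split=> // Aw; apply: h.
rewrite measureD; last 3 first.
- exact: measurableI.
- by apply: measurableI => //; exact: measurableI.
- by rewrite ltey_eq fin_num_measure//; exact: measurableI.
have -> : B `&` X0 `&` (A e `&` B `&` X0) = A e `&` B `&` X0.
  by apply/seteqP; split => w /=; [case|move=> [[a b] c]].
have -> : B `&` (A e `&` X1) = A e `&` B `&` X1.
  by rewrite setIA (setIC B).
rewrite -capJe /B.
have h1 : P (\bigcap_(i in [set` (e |` J)%fset]) A i `&` X1) = _ :=
  IH (e |` J)%fset (fun w => Q (e |` w)) ues esD' JeD esJe.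
have h0 : P (\bigcap_(i in [set` (e |` J)%fset]) A i `&` X0) = _ :=
  IH (e |` J)%fset Q ues esD' JeD esJe.
have h : P (\bigcap_(i in [set` J]) A i `&` X0) = _ := IH J Q ues esD' JD esJ'.
apply: etrans (congr2 (fun a b => a + b)%E h1 (congr2 (fun a b => a - b)%E h h0)) _.
rewrite /= -EFinB -EFinD big_fsetU1//=; congr (_%:E).
ring.
Qed.

Lemma prob_cfg (es : seq I) (Q : set I -> Prop) :
  uniq es -> [set` es] `<=` D ->
  P [set w | Q [set e | A e w /\ e \in es]] = (Ebern p es (fun w => indic R (Q w)))%:E.
Proof.
move=> ues esD; have := @prob_cfg_cond es fset0 Q ues esD.
rewrite big_seq_fset0 mul1r => <- //; congr (P _).
by apply/seteqP; split => w //= [].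
Qed.
End Transfer.

(** * Paths, reachability and capped distance *)

(* The bare name also denotes the theorem on adjacent sequences. *)
Local Notation adjacent := Defs.adjacent.

Section Reach.
Variable V : choiceType.
Implicit Types (E : set {fset V}) (x y z : V) (n : nat).

Definition reach E n x y : Prop :=
  exists p, [/\ path (adjacent E) x p, last x p = y & (size p <= n)%N].

(** The graph distance capped at [L], as the first success of a bounded search. *)
Definition hops (L : nat) E x y : nat :=
  find (fun k => `[< reach E k x y >]) (iota 0 L).

Definition path_edges x (p : seq V) : seq {fset V} :=
  pairmap (fun a b => [fset a; b]%fset) x p.

Lemma path_edgesP E x p :
  path (adjacent E) x p <-> [set` path_edges x p] `<=` E.
Proof.
elim: p x => [|y p IH] x /=; first by split.
rewrite /adjacent; split.
  move=> /andP[/set_mem xy /IH yp] e /=; rewrite in_cons => /orP[/eqP -> //|].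
  exact: yp.
move=> h; apply/andP; split; first by apply/mem_set/h => /=; rewrite mem_head.
by apply/IH => e ep; apply: h => /=; rewrite in_cons; apply/orP; right.
Qed.

Lemma path_edges_fset2 x p e : e \in path_edges x p ->
  exists a b, e = [fset a; b]%fset.
Proof.
by elim: p x => [//|y p IH] x /=; rewrite in_cons => /orP[/eqP ->|/IH//]; exists x, y.
Qed.

Lemma path_edges_sub x p e v : e \in path_edges x p -> v \in e -> v \in x :: p.
Proof.
elim: p x => [//|y p IH] x /=; rewrite in_cons => /orP[/eqP ->|ep ve].
  by rewrite !inE => /orP[/eqP ->|/eqP ->]; rewrite eqxx ?orbT.
by rewrite in_cons (IH y)// orbT.
Qed.

Lemma path_edges_neq0 x p e : e \in path_edges x p -> exists v, v \in e.
Proof.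
elim: p x => [//|y p IH] x /=; rewrite in_cons => /orP[/eqP ->|/IH//].
by exists x; rewrite !inE eqxx.
Qed.

Lemma path_edges_sub_vertices x p (E : set {fset V}) (Vs : seq V) :
  (forall e, E e -> forall v, v \in e -> v \in Vs) ->
  x \in Vs -> path (adjacent E) x p -> {subset x :: p <= Vs}.
Proof.
move=> EV; elim: p x => [|y p IH] x xV /=.
  by move=> _ v; rewrite inE => /eqP ->.
rewrite /adjacent => /andP[/set_mem xy yp] v; rewrite in_cons => /orP[/eqP ->//|].
by apply: IH => //; apply: (EV _ xy); rewrite !inE eqxx orbT.
Qed.

Lemma reach_le E E' n n' x y : E `<=` E' -> (n <= n')%N ->
  reach E n x y -> reach E' n' x y.
Proof.
move=> EE' nn' [p [/path_edgesP xp pl pn]]; exists p; split => //.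
  by apply/path_edgesP; exact: subset_trans EE'.
exact: leq_trans nn'.
Qed.

Lemma reach_refl E n x : reach E n x x.
Proof. by exists [::]. Qed.

Lemma reach_edge E x y : E [fset x; y]%fset -> reach E 1 x y.
Proof. by move=> Exy; exists [:: y]; split => //=; rewrite andbT; exact/mem_set. Qed.

Lemma reach_trans E m n x y z : reach E m x y -> reach E n y z ->
  reach E (m + n) x z.
Proof.
move=> [p [xp py pm]] [q [yq qz qn]]; exists (p ++ q); split.
- by rewrite cat_path xp py.
- by rewrite last_cat py.
- by rewrite size_cat leq_add.
Qed.

Lemma adjacent_sym E x y : adjacent E x y = adjacent E y x.
Proof. by rewrite /adjacent fsetUC. Qed.

Lemma reach_sym E n x y : reach E n x y -> reach E n y x.
Proof.
move=> [p [xp <- pn]]; exists (rev (belast x p)); split.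
- by rewrite rev_path; apply: sub_path xp => a b; rewrite adjacent_sym.
- by case: p xp pn => [//|a p] /= _ _; rewrite rev_cons last_rcons.
- by rewrite size_rev size_belast.
Qed.

Lemma reach_uniq E n x y : reach E n x y ->
  exists p, [/\ path (adjacent E) x p, last x p = y, (size p <= n)%N & uniq (x :: p)].
Proof.
move=> [p [xp <- pn]]; case/shortenP: xp => p' xp' up' pp'.
exists p'; split => //; apply: leq_trans pn; apply: uniq_leq_size => //.
by case/andP: up'.
Qed.

Lemma hops_leL L E x y : (hops L E x y <= L)%N.
Proof. by rewrite -{2}(size_iota 0 L) find_size. Qed.

Lemma hops_le L E n x y : reach E n x y -> (hops L E x y <= n)%N.
Proof.
move=> r; have [nL|Ln] := ltnP n L; last exact: leq_trans (hops_leL _ _ _ _) Ln.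
rewrite leqNgt; apply/negP => h.
have := before_find 0%N h; rewrite nth_iota// add0n => /negP; apply.
exact/asboolP.
Qed.

Lemma hopsP L E x y : (hops L E x y < L)%N -> reach E (hops L E x y) x y.
Proof.
rewrite -{2}(size_iota 0 L) -has_find => h.
have := nth_find 0%N h; rewrite -/(hops _ _ _ _) nth_iota ?add0n; first by move/asboolP.
by move: h; rewrite has_find size_iota.
Qed.

Lemma hops_mono L E E' x y : E `<=` E' -> (hops L E' x y <= hops L E x y)%N.
Proof.
move=> EE'; have [h|h] := ltnP (hops L E x y) L; last first.
  exact: leq_trans (hops_leL _ _ _ _) h.
by apply: hops_le; apply: reach_le (hopsP h).
Qed.

Lemma hops_trans L E x y z : (hops L E x z <= hops L E x y + hops L E y z)%N.
Proof.
have [h|h] := ltnP (hops L E x y) L; last first.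
  by rewrite (leq_trans (hops_leL _ _ _ _))// (leq_trans h)// leq_addr.
have [h'|h'] := ltnP (hops L E y z) L; last first.
  by rewrite (leq_trans (hops_leL _ _ _ _))// (leq_trans h')// leq_addl.
by apply: hops_le; apply: reach_trans (hopsP h) (hopsP h').
Qed.

Lemma hops_sym L E x y : hops L E x y = hops L E y x.
Proof.
rewrite /hops; apply: eq_find => k; apply/asboolP/asboolP; exact: reach_sym.
Qed.

End Reach.

Section PathBK.
Variables (R : realType) (V : choiceType) (p : {fset V} -> R).
Hypothesis p01 : forall e, 0 <= p e <= 1.

Definition reach_prob (es : seq {fset V}) n x y : R :=
  Ebern p es (fun w => indic R (reach w n x y)).

Lemma reach_prob01 es n x y : 0 <= reach_prob es n x y <= 1.
Proof.
apply/andP; split.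
  by apply: Ebern_ge0 => // w _; case/andP: (indic01 R (reach w n x y)).
rewrite -(Ebern_cst p es 1); apply: Ebern_le => // w _.
by case/andP: (indic01 R (reach w n x y)).
Qed.

Lemma reach_prob_sym es n x y : reach_prob es n x y = reach_prob es n y x.
Proof.
apply: Ebern_ext => // w _; apply: indic_eq; split; exact: reach_sym.
Qed.

(** Uniqueness of the vertices makes the edges of the first part, the edge
    between [z] and [z'] and the edges of the second part disjoint, so that the
    van den Berg-Kesten inequality applies. *)
Definition through_edge a b x z z' y (w : set {fset V}) : Prop :=
  exists p1 p2, [/\ path (adjacent w) x (p1 ++ z' :: p2), uniq (x :: p1 ++ z' :: p2),
    last x p1 = z, last z' p2 = y & (size p1 <= a)%N /\ (size p2 <= b)%N].

Lemma indicM (Q Q' : Prop) : indic R (Q /\ Q') = indic R Q * indic R Q'.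
Proof. by rewrite /indic asbool_and -mulnb natrM. Qed.

(** Three disjoint occurrences: the path to [z], the edge, and the path from
    [z'].  The van den Berg-Kesten inequality is used first with [PP], to
    separate the path to [z], and then with [PQ], to separate the edge from the
    rest. *)
Lemma through_edge_prob es a b x z z' y : uniq es ->
  Ebern p es (fun w => indic R (through_edge a b x z z' y w)) <=
  reach_prob es a x z * (p [fset z; z']%fset * reach_prob es b z' y).
Proof.
move=> ues.
pose PQ := [set AB : set {fset V} * set {fset V} | AB.1 = [set [fset z; z']%fset] /\
  exists p2, [/\ AB.2 = [set` path_edges z' p2], last z' p2 = y & (size p2 <= b)%N]].
pose PP := [set AB : set {fset V} * set {fset V} |
  (exists p1, [/\ AB.1 = [set` path_edges x p1], last x p1 = z & (size p1 <= a)%N])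
  /\ (exists B, [/\ PQ ([set [fset z; z']%fset], B),
       [set [fset z; z']%fset] `&` B = set0 & AB.2 = [fset z; z']%fset |` B])].
apply: (@le_trans _ _ (Ebern p es (fun w => indic R (disj_occ PP w)))).
  apply: Ebern_le => // w _; apply: indic_le => -[p1 [p2 [xp up p1z p2y [p1a p2b]]]].
  move: xp; rewrite cat_path p1z /= => /and3P[xp1 zz' z'p2].
  move: up; rewrite -cat_cons cat_uniq => /and3P[up1 /hasPn up12 up2].
  exists ([set` path_edges x p1], [fset z; z']%fset |` [set` path_edges z' p2]).
    split; first by exists p1.
    exists [set` path_edges z' p2]; split => //; first by split => //; exists p2.
    apply/seteqP; split => // e /= [-> ep2].
    have zp2 : z \in z' :: p2 by apply: (path_edges_sub ep2); rewrite !inE eqxx.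
    by have := up12 _ zp2; rewrite -p1z /= mem_last.
  split => /=.
  - apply/seteqP; split => // e /= [ep1 [eE|ep2]].
      have z'p1 : z' \in x :: p1.
        by apply: (path_edges_sub ep1); rewrite eE !inE eqxx orbT.
      by have := up12 z' (mem_head _ _); rewrite /= z'p1.
    have [v ve] := path_edges_neq0 ep1.
    have := up12 _ (path_edges_sub ep2 ve).
    by rewrite /= (path_edges_sub ep1 ve).
  - exact/path_edgesP.
  - move=> e /= [->|]; first exact: set_mem zz'.
    by move: e; apply/path_edgesP.
apply: le_trans (BK_inequality p01 PP ues) _.
have step w w' : indic R (indep_occ PP w w') <=
    indic R (disj_occ PQ w') * indic R (reach w a x z).
  rewrite -indicM; apply: indic_le.
  move=> -[[A B] [[p1 [/= -> p1z p1a]] [B' [PQB' dj ->]]] [Aw Bw]].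
  split.
    exists ([set [fset z; z']%fset], B') => //; split => // e eB.
      by apply: Bw; left.
    by apply: Bw; right.
  by exists p1; split => //; exact/path_edgesP.
apply: (@le_trans _ _ (Ebern p es (fun w =>
    Ebern p es (fun w' => indic R (disj_occ PQ w')) * indic R (reach w a x z)))).
  apply: Ebern_le => // w _; rewrite mulrC -EbernZ; apply: Ebern_le => // w' _.
  by rewrite mulrC.
rewrite EbernZ mulrC; apply: ler_wpM2l; first by case/andP: (reach_prob01 es a x z).
apply: le_trans (BK_inequality p01 PQ ues) _.
have step' w w' : indic R (indep_occ PQ w w') <=
    indic R (reach w' b z' y) * indic R (w [fset z; z']%fset).
  rewrite -indicM; apply: indic_le => -[[A B] [/= -> [p2 [-> p2y p2b]]] [Aw Bw]].
  split; last exact: Aw.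
  by exists p2; split => //; exact/path_edgesP.
apply: (@le_trans _ _ (Ebern p es (fun w =>
    reach_prob es b z' y * indic R (w [fset z; z']%fset)))).
  apply: Ebern_le => // w _; rewrite mulrC -EbernZ; apply: Ebern_le => // w' _.
  by rewrite mulrC.
rewrite EbernZ mulrC; apply: ler_wpM2r; first by case/andP: (reach_prob01 es b z' y).
exact: Ebern_mem.
Qed.

End PathBK.

(** * The lattice and comparison of norms *)

Section Lattice.
Variable d : nat.
Local Notation V := 'rV[int]_d.
Implicit Types x y z : V.

(** The sup distance, with values in [nat]: all norms are equivalent, and the
    combinatorial arguments are done at integer scales. *)
Definition dist x y : nat := \max_(i < d) `|(x 0 i - y 0 i)%R|%N.

Lemma le_dist x y i : (`|(x 0 i - y 0 i)%R|%N <= dist x y)%N.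
Proof. by rewrite /dist (bigD1 i) //= leq_maxl. Qed.

Lemma dist_leP x y k :
  reflect (forall i, (`|(x 0 i - y 0 i)%R| <= k)%N) (dist x y <= k)%N.
Proof.
apply: (iffP (bigmax_leqP _ _ _)) => h i; last by move=> _; exact: h.
exact: (h i isT).
Qed.

Lemma dist_sym x y : dist x y = dist y x.
Proof. by apply: eq_bigr => i _; rewrite distnC. Qed.

Lemma dist_refl x : dist x x = 0%N.
Proof. by apply/eqP; rewrite -leqn0; apply/dist_leP => i; rewrite subrr. Qed.

Lemma dist_eq0 x y : (dist x y == 0%N) = (x == y).
Proof.
apply/idP/eqP => [|->]; last by rewrite dist_refl.
rewrite -leqn0 => /dist_leP h; apply/rowP => i; apply/eqP.
by rewrite -subr_eq0 -absz_eq0 -leqn0.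
Qed.

Lemma dist_triangle z x y : (dist x y <= dist x z + dist z y)%N.
Proof.
apply/dist_leP => i; have := le_dist x z i; have := le_dist z y i; lia.
Qed.

Definition box x (k : nat) : seq V :=
  [seq \row_i (x 0 i + (f i : nat)%:Z - k%:Z) |
     f : {ffun 'I_d -> 'I_(2 * k + 1)} <- enum {: {ffun 'I_d -> 'I_(2 * k + 1)}}].

Lemma size_box x k : size (box x k) = ((2 * k + 1) ^ d)%N.
Proof. by rewrite size_map -cardE card_ffun !card_ord. Qed.

Lemma uniq_box x k : uniq (box x k).
Proof.
rewrite map_inj_uniq ?enum_uniq// => f g /rowP fg; apply/ffunP => i.
by have := fg i; rewrite !mxE => /addIr/addrI [h]; apply/val_inj.
Qed.

Lemma mem_box x k y : (y \in box x k) = (dist x y <= k)%N.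
Proof.
apply/mapP/dist_leP => [[f _ ->] i|h].
  by move: (ltn_ord (f i)); rewrite !mxE; move: (x 0 i) (nat_of_ord (f i)) => a b; lia.
have lt i : (`|(y 0 i - x 0 i + k%:Z)%R| < 2 * k + 1)%N by have := h i; lia.
exists [ffun i => Ordinal (lt i)]; first by rewrite mem_enum.
by apply/rowP => i; rewrite !mxE ffunE /=; have := h i; lia.
Qed.

Definition nn_edges : set {fset V} :=
  [set e | exists x y, nearest_neighbor x y /\ e = [fset x; y]%fset].

(** Each step decreases the l1-distance to [y] by one. *)
Lemma reach_nn_sum (E : set {fset V}) x y : nn_edges `<=` E ->
  reach E (\sum_(i < d) `|(x 0 i - y 0 i)%R|%N) x y.
Proof.
move=> nnE; move e : (\sum_(i < d) _)%N => n.
elim: n x e => [|n IH] x e.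
  have -> : x = y.
    apply/rowP => i; apply/eqP; move/eqP: e; rewrite sum_nat_eq0 => /forallP/(_ i).
    by rewrite absz_eq0 subr_eq0.
  exact: reach_refl.
have [i xyi] : exists i, x 0 i != y 0 i.
  apply/existsP; rewrite -negb_forall; apply/negP => /forallP h.
  move: e; rewrite big1// => i _; move/eqP: (h i) => ->; by rewrite subrr.
pose t : int := if x 0 i < y 0 i then 1 else -1.
pose x' : V := \row_j (if j == i then x 0 j + t else x 0 j).
have x'E j : j != i -> x' 0 j = x 0 j by move=> /negbTE ji; rewrite mxE ji.
have x'i : x' 0 i = x 0 i + t by rewrite mxE eqxx.
rewrite -(add1n n); apply: (@reach_trans _ _ _ _ _ x').
  apply/reach_edge/nnE; exists x, x'; split => //.
  rewrite /nearest_neighbor (bigD1 i)//= big1 ?addr0; last first.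
    by move=> j ji; rewrite x'E// subrr normr0.
  by rewrite x'i /t; case: ifP; lia.
apply: IH; move: e; rewrite (bigD1 i)//= [in X in _ -> X](bigD1 i)//= x'i.
have -> : (\sum_(j < d | j != i) `|(x' 0 j - y 0 j)%R| =
    \sum_(j < d | j != i) `|(x 0 j - y 0 j)%R|)%N.
  by apply: eq_bigr => j ji; rewrite x'E.
rewrite /t; move: xyi.
by case: ifP; move: (x 0 i) (y 0 i) => a b h1 h2; set S := (\sum_(j < d | _) _)%N; lia.
Qed.

Lemma reach_nn (E : set {fset V}) x y : nn_edges `<=` E ->
  reach E (d * dist x y) x y.
Proof.
move=> nnE; apply: reach_le (reach_nn_sum x y nnE) => //.
rewrite -[X in (_ <= X * _)%N](card_ord d) -sum_nat_const.
by apply: leq_sum => i _; exact: le_dist.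
Qed.

End Lattice.

Section NormEquiv.
Variables (R : realType) (d : nat) (N : 'rV[R]_d -> R).
Hypothesis (hd : (1 <= d)%N) (hN : is_norm N).

Lemma is_norm0 : N 0 = 0.
Proof. by rewrite -(scale0r (0 : 'rV[R]_d)) (norm_scale hN) normr0 mul0r. Qed.

Lemma is_normN x : N (- x) = N x.
Proof. by rewrite -scaleN1r (norm_scale hN) normrN1 mul1r. Qed.

Lemma is_norm_ge0 x : 0 <= N x.
Proof.
have := norm_triangle hN x (- x); rewrite subrr is_norm0 is_normN; lra.
Qed.

Lemma is_norm_sum (J : Type) (s : seq J) (F : J -> 'rV[R]_d) :
  N (\sum_(j <- s) F j) <= \sum_(j <- s) N (F j).
Proof.
elim: s => [|j s IH]; first by rewrite !big_nil is_norm0.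
rewrite !big_cons; apply: le_trans (norm_triangle hN _ _) _.
by rewrite lerD2l.
Qed.

Lemma is_norm_le_sup : exists2 c, 0 < c & forall v, N v <= c * `|v|.
Proof.
exists (1 + \sum_(i < d) N (delta_mx 0 i)).
  by rewrite ltr_pwDl// sumr_ge0// => i _; exact: is_norm_ge0.
move=> v; rewrite {1}(row_sum_delta v); apply: le_trans (is_norm_sum _ _) _.
rewrite mulrDl mul1r mulr_suml.
apply: (@le_trans _ _ (\sum_(i < d) N (delta_mx 0 i) * `|v|)).
  apply: ler_sum => i _; rewrite (norm_scale hN) mulrC ler_wpM2l ?is_norm_ge0//.
  rewrite [leRHS]/Num.norm /= mx_normrE; apply/bigmax_geP; right => /=.
  by exists (0, i).
by rewrite lerDr.
Qed.

(** A norm is continuous and positive on the unit sphere of the sup norm, which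
    is compact. *)
Lemma is_norm_ge_sup : exists2 c, 0 < c & forall v, c * `|v| <= N v.
Proof.
have [C C0 NC] := is_norm_le_sup.
pose S := [set v : 'rV[R]_d | `|v| = 1].
have cN : continuous N.
  move=> x; apply/(@cvgrPdist_le _ _ _ (nbhs x) (nbhs_filter x)) => e e0.
  have eC : 0 < e / C by rewrite divr_gt0.
  apply/nbhs_ballP; exists (e / C) => //= y; rewrite -ball_normE /= => /ltW h.
  have h1 := norm_triangle hN (x - y) y; have h2 := norm_triangle hN (y - x) x.
  rewrite !subrK in h1 h2; rewrite -[y - x]opprB is_normN in h2.
  have h3 : N (x - y) <= e.
    by apply: le_trans (NC _) _; rewrite -ler_pdivlMl// mulrC.
  rewrite ler_norml; apply/andP; split; lra.
have cS : compact S.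
  apply: bounded_closed_compact.
    by exists 1; split => // M M1 v /= ->; exact: ltW.
  rewrite (_ : S = (fun v => `|v|) @^-1` [set 1])//.
  apply: closed_comp; last exact: closed_eq.
  by move=> v _; exact: norm_continuous.
have S0 : S !=set0.
  pose i0 : 'I_d := Ordinal hd.
  exists (const_mx 1); rewrite /S /= {1}/Num.norm /= mx_normrE.
  apply/eqP; rewrite eq_le; apply/andP; split.
    by apply/bigmax_leP; split => // -[i j] _; rewrite mxE normr1.
  by apply/bigmax_geP; right; exists (0, i0) => //=; rewrite mxE normr1.
have [c cS' Nc] := EVT_min_rV S0 cS (continuous_subspaceT cN).
move: cS'; rewrite inE /S /= => c1.
have Nc0 : 0 < N c.
  rewrite lt_neqAle is_norm_ge0 andbT eq_sym; apply/eqP => /(norm_definite hN) c0.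
  by move: c1; rewrite c0 normr0 => /eqP; rewrite eq_sym oner_eq0.
exists (N c) => // v; have [->|v0] := eqVneq v 0.
  by rewrite normr0 mulr0 is_norm0.
have vp : 0 < `|v| by rewrite normr_gt0.
have /Nc : (`|v|^-1 *: v) \in S.
  by rewrite inE /S /= normrZ normfV normr_id mulVf// gt_eqF.
rewrite (norm_scale hN) normfV normr_id => h.
by rewrite mulrC -ler_pdivlMl.
Qed.

Lemma embed_sup_norm (x y : 'rV[int]_d) :
  `|embedZ R x - embedZ R y| = (dist x y)%:R.
Proof.
rewrite {1}/Num.norm /= mx_normrE; apply/eqP; rewrite eq_le; apply/andP; split.
  apply/bigmax_leP; split => // -[i j] _ /=; rewrite !mxE ord1 -rmorphB /= -intr_norm.
  by rewrite -abszE -[leLHS]/(_%:R) ler_nat; exact: le_dist.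
have [|i iE] := @bigop.eq_bigmax 'I_d (fun i => `|(x 0 i - y 0 i)%R|%N).
  by rewrite card_ord.
rewrite /dist iE; apply/bigmax_geP; right; exists (0, i) => //=.
by rewrite !mxE -rmorphB /= -intr_norm -abszE.
Qed.

End NormEquiv.

(** * The growth recursion *)

Section Growth.
Variable R : realType.

Lemma powR_le (r x y : R) : 0 <= r -> 0 <= x -> x <= y -> x `^ r <= y `^ r.
Proof.
by move=> r0 x0 xy; apply: ge0_ler_powR; rewrite ?nnegrE// (le_trans x0).
Qed.

(** Concavity of the power [th] at the midpoint, obtained from the convexity of
    the power [1 / th]. *)
Lemma powRD_le_half (th a b : R) : 0 < th < 1 -> 0 <= a -> 0 <= b ->
  a `^ th + b `^ th <= 2 `^ (1 - th) * (a + b) `^ th.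
Proof.
move=> /andP[th0 th1] a0 b0.
have p1 : 1 <= th^-1 by rewrite invf_ge1// ltW.
have h01 : (0 <= (2^-1 : R)) by rewrite invr_ge0.
have h11 : ((2^-1 : R) <= 1) by rewrite invf_le1// ler1n.
have /= := @convex_powR R _ p1 (Itv01 h01 h11) (a `^ th) (b `^ th).
rewrite !inE /= !in_itv /= !powR_ge0 => /(_ isT isT).
rewrite [X in X `^ _ <= _]convRE [X in _ <= X]convRE /= -!powRrM !mulfV ?gt_eqF// !powRr1//.
have HH : unstable.onem (2^-1 : R) = 2^-1 by rewrite /unstable.onem; lra.
rewrite HH.
rewrite -!mulrDr => h.
have s0 : 0 <= 2^-1 * (a `^ th + b `^ th) :> R by rewrite mulr_ge0// addr_ge0 ?powR_ge0.
have := @ge0_ler_powR R th (ltW th0) _ _ _ _ h.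
rewrite !nnegrE powR_ge0 mulr_ge0 ?addr_ge0// => /(_ isT isT).
rewrite -powRrM mulVf ?gt_eqF// powRr1// powRM ?addr_ge0//.
rewrite powRB ?pnatr_eq0 ?implybT// powRr1// => h'.
rewrite mulrAC -mulrA -ler_pdivrMl// (le_trans h')//.
by rewrite mulrC ler_wpM2l ?powR_ge0// -powR_inv1// -powRrM mulN1r powRN.
Qed.

Lemma ln_le_powR (th x : R) : 0 < th -> 0 < x -> ln x <= x `^ th / th.
Proof.
move=> th0 x0; rewrite ler_pdivlMr// mulrC -ln_powR.
by apply/ltW/ln_sublinear; rewrite powR_gt0.
Qed.

(** A supersolution of the recursion for the logarithm of the expected ball
    size, of the form K k^th - M ln k - M' at k = n + 1.  The two indices a and b
    then add up to k.  As 2^th = 2 al, the main term satisfies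
    al (a^th + b^th) <= k^th, with near equality only when a and b are
    comparable to k.  If they are, the inhomogeneity A + B ln k is paid by
    - M ln k - M', since these terms occur on the left with the factor
    2 al > 1; if one of them is less than t0 k, the strict concavity leaves a
    positive multiple of k^th, which exceeds every logarithm. *)
Lemma growth_function (al th A B : R) : 2^-1 < al < 1 -> 0 < th < 1 ->
  2 `^ th = 2 * al -> 0 <= A -> 0 <= B ->
  exists K, exists h : nat -> R,
  [/\ 0 < K, forall n, 0 <= h n <= K * (n.+1)%:R `^ th &
   forall a b n, (a + b).+1 = n -> A + B * ln n%:R + al * (h a + h b) <= h n].
Proof.
move=> /andP[al2 al1] th01 thE A0 B0; have /andP[th0 th1] := th01.
(* [tau] is chosen so that 1 - al (1 + tau) = de > 0: this is the gain when the
   smaller index is below t0 k, with t0^th = tau. *)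
pose e := 2 * al - 1; pose de := (1 - al) / 2; pose tau := (1 - al) / (2 * al).
have e0 : 0 < e by rewrite /e; lra.
have al0 : 0 < al by lra.
have de0 : 0 < de by rewrite /de; lra.
have tau0 : 0 < tau by rewrite /tau divr_gt0//; lra.
have tau1 : tau < 1 by rewrite /tau ltr_pdivrMr; lra.
pose t0 := tau `^ th^-1.
have t0p : 0 < t0 by rewrite powR_gt0.
have t01 : t0 <= 1.
  have := @powR_le th^-1 tau 1; rewrite powR1 invr_ge0.
  by apply; exact: ltW.
have t0th : t0 `^ th = tau by rewrite /t0 -powRrM mulVf ?gt_eqF// powRr1// ltW.
pose M := B / e; pose M' := (A + 2 * al * M * (- ln t0)) / e.
have M0 : 0 <= M by rewrite divr_ge0// ltW.
have lt0 : 0 <= - ln t0 by rewrite oppr_ge0 ln_le0.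
have al2_0 : 0 <= 2 * al by lra.
have M'0 : 0 <= M'.
  apply: divr_ge0; last exact: ltW.
  by apply: addr_ge0 => //; apply: mulr_ge0 => //; exact: mulr_ge0.
pose K := 1 + M' + M / th + (A + (B + M) / th) / de.
have BM0 : 0 <= (B + M) / th by apply: divr_ge0; [exact: addr_ge0|exact: ltW].
have Mth0 : 0 <= M / th by apply: divr_ge0 => //; exact: ltW.
have Kd0 : 0 <= (A + (B + M) / th) / de.
  by apply: divr_ge0; [exact: addr_ge0|exact: ltW].
have K1 : M' + M / th <= K by rewrite /K; lra.
have K2 : A + (B + M) / th <= K * de by rewrite -ler_pdivrMr// /K; lra.
have K0 : 0 < K by rewrite /K; lra.
pose H (k : R) := K * k `^ th - M * ln k - M'.
have H0 k : 1 <= k -> 0 <= H k <= K * k `^ th.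
  move=> k1; have k0 : 0 < k by lra.
  have kt1 : 1 <= k `^ th by rewrite -(powRr0 k) ler_powR// ltW.
  have lk := ln_le_powR th0 k0; have lk0 : 0 <= ln k by rewrite ln_ge0.
  apply/andP; split; last by have := mulr_ge0 M0 lk0; rewrite /H; lra.
  have h1 : M * ln k <= M / th * k `^ th by rewrite -mulrA (mulrC th^-1) ler_wpM2l.
  have h2 : M' <= M' * k `^ th by rewrite ler_peMr.
  have h3 : (M' + M / th) * k `^ th <= K * k `^ th by rewrite ler_wpM2r ?powR_ge0.
  rewrite mulrDl in h3.
  by rewrite /H; lra.
have main a b : 1 <= a -> a <= b -> A + B * ln (a + b) + al * (H a + H b) <= H (a + b).
  move=> a1 ab; set k := a + b.
  have a0 : 0 < a by lra.
  have b0 : 0 < b by lra.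
  have k1 : 1 <= k by rewrite /k; lra.
  have k0 : 0 < k by lra.
  have lk := ln_le_powR th0 k0; have lk0 : 0 <= ln k by rewrite ln_ge0.
  have la0 : 0 <= ln a by rewrite ln_ge0.
  have lb0 : 0 <= ln b by rewrite ln_ge0//; lra.
  have kt1 : 1 <= k `^ th by rewrite -(powRr0 k) ler_powR// ltW.
  suff : A + B * ln k <= K * (k `^ th - al * (a `^ th + b `^ th))
        + M * (al * (ln a + ln b) - ln k) + e * M'.
    by rewrite /H /e; lra.
  have [ak|ak] := ltP a (t0 * k).
    have at0 : a `^ th <= tau * k `^ th.
      by rewrite -t0th -(powRM _ (ltW t0p) (ltW k0)); apply: powR_le; lra.
    have bt0 : b `^ th <= k `^ th.
      by apply: powR_le; rewrite /k; lra.
    have G : de * k `^ th <= k `^ th - al * (a `^ th + b `^ th).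
      have : al * (a `^ th + b `^ th) <= al * (tau * k `^ th + k `^ th).
        by rewrite ler_wpM2l ?(ltW al0)// lerD.
      have -> : al * (tau * k `^ th + k `^ th) = (1 - al) / 2 * k `^ th + al * k `^ th.
        by rewrite /tau; field; rewrite gt_eqF.
      rewrite /de; lra.
    have h1 : K * (de * k `^ th) <= K * (k `^ th - al * (a `^ th + b `^ th)).
      by rewrite ler_wpM2l ?(ltW K0).
    have h2 : (A + (B + M) / th) * k `^ th <= K * de * k `^ th.
      by rewrite ler_wpM2r ?powR_ge0.
    have h3 : A <= A * k `^ th by rewrite ler_peMr.
    have h4 : (B + M) * ln k <= (B + M) / th * k `^ th.
      by rewrite -mulrA (mulrC th^-1) ler_wpM2l// addr_ge0.
    have h5 : 0 <= M * (al * (ln a + ln b)) 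
      by apply: mulr_ge0 => //; apply: mulr_ge0; [lra|exact: addr_ge0].
    have h6 : 0 <= e * M' by rewrite mulr_ge0// ltW.
    lra.
  have G : 0 <= k `^ th - al * (a `^ th + b `^ th).
    rewrite subr_ge0 -ler_pdivlMl//.
    apply: le_trans (powRD_le_half th01 (ltW a0) (ltW b0)) _.
    rewrite powRB ?pnatr_eq0 ?implybT// powRr1// thE invfM mulrA divff ?mul1r//.
  have la : ln k + ln t0 <= ln a.
    by rewrite addrC -lnM ?posrE// ler_ln ?posrE// mulr_gt0.
  have lab : ln a <= ln b by rewrite ler_ln ?posrE.
  have h1 : 0 <= K * (k `^ th - al * (a `^ th + b `^ th)).
    by apply: mulr_ge0 => //; exact: ltW.
  have h2 : M * (al * (2 * (ln k + ln t0))) <= M * (al * (ln a + ln b)).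
    rewrite ler_wpM2l// ler_wpM2l ?(ltW al0)//; lra.
  have h3 : e * M' = A + 2 * al * M * (- ln t0) by rewrite /M'; field; rewrite gt_eqF.
  have h4 : M * e = B by rewrite /M; field; rewrite gt_eqF.
  rewrite h3 -h4 /e; lra.
exists K; exists (fun n => H n.+1%:R); split => //.
  by move=> n; apply: H0; rewrite ler1n.
move=> a b n nE.
have -> : n.+1%:R = a.+1%:R + b.+1%:R :> R by rewrite -natrD -nE addSn addnS.
have lnn : B * ln n%:R <= B * ln (a.+1%:R + b.+1%:R).
  rewrite ler_wpM2l// ler_ln ?posrE -?natrD ?ler_nat ?ltr0n -?nE//.
  by rewrite addSn addnS.
have [ab|ab] := leqP a b.
  have := @main a.+1%:R b.+1%:R; rewrite ler1n ler_nat => /(_ isT ab); lra.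
have := @main b.+1%:R a.+1%:R; rewrite ler1n ler_nat => /(_ isT (ltnW ab)).
rewrite (addrC b.+1%:R); lra.
Qed.

End Growth.

(** * Sums over layers around a point *)

Lemma powRN_le (R : realType) (r x y : R) : 0 <= r -> 0 < x -> x <= y ->
  y `^ (- r) <= x `^ (- r).
Proof.
move=> r0 x0 xy; rewrite !powRN lef_pV2 ?posrE ?powR_gt0//.
  by apply: powR_le => //; exact: ltW.
exact: lt_le_trans xy.
Qed.

Section LayerSum.
Variables (R : realType) (d : nat).
Local Notation V := 'rV[int]_d.

Lemma count_ball (x : V) (Vs : seq V) (r : R) : uniq Vs -> 1 <= r ->
  (count (fun y => (dist x y)%:R <= r) Vs)%:R <= (3 * r) ^+ d.
Proof.
move=> uV r1; have r0 : 0 <= r by lra.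
have [k /andP[kr rk]] : exists k : nat, (k%:R <= r < k.+1%:R).
  by exists (Num.truncn r); rewrite truncn_itv.
apply: (@le_trans _ _ ((2 * k + 1) ^ d)%:R).
  rewrite ler_nat -(size_box x) -size_filter; apply: uniq_leq_size.
    exact: filter_uniq.
  move=> y; rewrite mem_filter mem_box => /andP[h _].
  by have := le_lt_trans h rk; rewrite ltr_nat.
rewrite natrX; apply: lerXn2r; rewrite ?nnegrE ?ler0n ?mulr_ge0//.
by rewrite natrD natrM; lra.
Qed.

(** With r0 = K^(1/s), the layer 2^J r0 < dist x y <= 2^(J+1) r0 has at most
    (6 2^J r0)^d points, and on it [f] is at most 2^(- J s).  As d < s the
    layers contribute a geometric series, of order r0^d = K^(d/s). *)
Lemma layer_sum (s : R) : (0 < d)%N -> d%:R < s ->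
  exists2 C, 1 <= C & forall (x : V) (Vs : seq V) (f : V -> R) (K : R),
    uniq Vs -> 1 <= K -> (forall y, 0 <= f y <= 1) ->
    (forall y, y != x -> f y <= K * (dist x y)%:R `^ (- s)) ->
    \sum_(y <- Vs) f y <= C * K `^ (d%:R / s).
Proof.
move=> d0 ds.
have d1 : 1 <= d%:R :> R by rewrite ler1n.
have s0 : 0 < s by lra.
pose q : R := 2 `^ (d%:R - s).
have q0 : 0 < q by exact: powR_gt0.
have q1 : q < 1.
  rewrite /q /powR pnatr_eq0 /= expR_lt1 nmulr_rlt0 ?subr_lt0// ln_gt0//.
  by rewrite ltr1n.
exists (3 ^+ d * (1 + 2 ^+ d / (1 - q))).
  have h1 : 1 <= 3 ^+ d :> R by rewrite exprn_ege1// ler1n.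
  have h2 : 0 <= 2 ^+ d / (1 - q) :> R by rewrite divr_ge0 ?exprn_ge0//; lra.
  by apply: mulr_ege1 => //; lra.
move=> x Vs f K uV K1 f01 fK.
have K0 : 0 < K by lra.
pose r0 := K `^ s^-1.
have r01 : 1 <= r0.
  have := @powR_le _ s^-1 1 K; rewrite powR1 invr_ge0; apply => //; lra.
have r0s : r0 `^ s = K by rewrite /r0 -powRrM mulVf ?gt_eqF// powRr1// ltW.
have r0d : r0 ^+ d = K `^ (d%:R / s).
  by rewrite -powR_mulrn ?powR_ge0// /r0 -powRrM mulrC.
have step J : \sum_(y <- Vs | (dist x y)%:R <= 2 ^+ J * r0) f y <=
    (3 * r0) ^+ d * (1 + 2 ^+ d * \sum_(j < J) q ^+ j).
  elim: J => [|J IH].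
    rewrite big_ord0 mulr0 addr0 mulr1 expr0 mul1r.
    apply: le_trans (count_ball x uV r01); rewrite -sum1_count natr_sum.
    by apply: ler_sum => y _; case/andP: (f01 y).
  have -> : (3 * r0) ^+ d * (1 + 2 ^+ d * \sum_(j < J.+1) q ^+ j) =
      (3 * r0) ^+ d * (1 + 2 ^+ d * \sum_(j < J) q ^+ j) +
      (3 * r0) ^+ d * 2 ^+ d * q ^+ J by rewrite big_ord_recr /=; ring.
  rewrite (bigID (fun y => (dist x y)%:R <= 2 ^+ J * r0)) /=.
  apply: lerD.
    apply: le_trans IH; rewrite le_eqVlt; apply/orP; left; apply/eqP.
    apply: eq_bigl => y; rewrite andb_idl// => h; apply: le_trans h _.
    by rewrite ler_wpM2r ?powR_ge0// ler_eXn2l ?ltr1n.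
  have rJ : 1 <= 2 ^+ J.+1 * r0 by rewrite mulr_ege1// exprn_ege1// ler1n.
  have tJ : 0 < 2 ^+ J :> R by rewrite exprn_gt0.
  apply: (@le_trans _ _
      (\sum_(y <- Vs | (dist x y)%:R <= 2 ^+ J.+1 * r0) (2 ^+ J) `^ (- s))).
    rewrite big_mkcondr; apply: ler_sum => y h1; case: ifPn => h2; last exact: powR_ge0.
    rewrite -ltNge in h2.
    have dp : 0 < 2 ^+ J * r0 by rewrite mulr_gt0// powR_gt0.
    have yx : y != x.
      by apply: contraTneq h2 => ->; rewrite dist_refl -leNgt ltW.
    apply: le_trans (fK y yx) _.
    apply: (@le_trans _ _ (K * (2 ^+ J * r0) `^ (- s))).
      by rewrite ler_wpM2l ?(ltW K0)//; apply: powRN_le (ltW s0) dp (ltW h2).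
    rewrite powRM ?powR_ge0 ?(ltW tJ)// [in X in _ * X](powRN r0) r0s.
    by rewrite mulrC mulfVK// gt_eqF.
  have qJ : (2 ^+ J) ^+ d * (2 ^+ J) `^ (- s) = q ^+ J :> R.
    rewrite -powR_mulrn ?(ltW tJ)// -powRD ?(gt_eqF tJ) ?implybT//.
    by rewrite -!powR_mulrn ?powR_ge0// /q -!powRrM mulrC.
  rewrite big_const_seq iter_addr_0 -[leLHS]mulr_natl -qJ mulrA.
  apply: ler_wpM2r; first exact: powR_ge0.
  apply: le_trans (count_ball x uV rJ) _; rewrite -!exprMn exprS.
  by have -> : 3 * (2 * 2 ^+ J * r0) = 3 * r0 * 2 * 2 ^+ J by ring.
pose J := (\max_(y <- Vs) dist x y)%N.
have -> : \sum_(y <- Vs) f y = \sum_(y <- Vs | (dist x y)%:R <= 2 ^+ J * r0) f y.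
  rewrite big_seq [RHS]big_seq_cond; apply: eq_bigl => y; rewrite andb_idr// => yV.
  have h : (dist x y <= J)%N by apply: leq_bigmax_seq.
  apply: (@le_trans _ _ (2 ^+ J)); last by rewrite ler_peMr// exprn_ge0.
  rewrite -natrX ler_nat; apply: leq_trans h _; exact/ltnW/ltn_expl.
apply: le_trans (step J) _.
rewrite exprMn r0d mulrAC ler_wpM2r ?powR_ge0// ler_wpM2l ?exprn_ge0//.
rewrite lerD2l ler_wpM2l ?exprn_ge0// -[X in _ <= X]mul1r ler_pdivlMr; last by lra.
have -> : (\sum_(j < J) q ^+ j) * (1 - q) = 1 - q ^+ J.
  elim: J {step} => [|J IH]; first by rewrite big_ord0 expr0 mul0r subrr.
  by rewrite big_ord_recr /= mulrDl IH exprSr; ring.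
by rewrite lerBlDr lerDl exprn_ge0// ltW.
Qed.
End LayerSum.

(** * Reaching a far point in few steps is unlikely *)

Section LowerBound.
Variables (R : realType) (d : nat) (s b1 : R).
Local Notation V := 'rV[int]_d.
Hypothesis (d0 : (0 < d)%N) (hs : d%:R < s < 2 * d%:R) (b11 : 1 <= b1).

Lemma long_edge (x : V) (p : seq V) : p != [::] ->
  exists p1 z p2, p = p1 ++ z :: p2 /\
    (dist x (last x p) <= size p * dist (last x p1) z)%N.
Proof.
elim: p x => [//|y p IH] x _.
have [->|p0] := eqVneq p [::].
  by exists [::], y, [::]; rewrite /= mul1n.
have [p1 [z [p2 [pE le]]]] := IH y p0.
have tri := dist_triangle y x (last y p).
have [h|h] := leqP (dist (last y p1) z) (dist x y).
  exists [::], y, p; split => //=; rewrite mulSn.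
  apply: leq_trans tri _; rewrite leq_add2l; apply: leq_trans le _.
  by rewrite leq_mul2l h orbT.
exists (y :: p1), z, p2; split; first by rewrite pE.
rewrite /= mulSn; apply: leq_trans tri _; apply: leq_add => //; exact: ltnW.
Qed.

Lemma ler_term_sum (J : eqType) (j : J) (r : seq J) (F : J -> R) :
  (forall i, 0 <= F i) -> j \in r -> F j <= \sum_(i <- r) F i.
Proof.
move=> F0 jr; rewrite (big_rem j)//= lerDl; exact: sumr_ge0.
Qed.

Section Step.
Variables (p : {fset V} -> R) (es : seq {fset V}) (Vs : seq V).
Hypothesis p01 : forall e, 0 <= p e <= 1.
Hypothesis pup : forall x y, x != y -> p [fset x; y]%fset <= b1 * (dist x y)%:R `^ (- s).
Hypothesis ues : uniq es.
Hypothesis esV : forall e, e \in es -> forall v, v \in e -> v \in Vs.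

Local Notation f := (reach_prob p es).

Lemma reach_through_long_edge n (w : set {fset V}) x y : w `<=` [set` es] ->
  x \in Vs -> y != x -> reach w n x y ->
  exists a : 'I_n, exists z z', [/\ z \in Vs, z' \in Vs, (dist x y <= n * dist z z')%N &
    through_edge a (n - a.+1)%N x z z' y w].
Proof.
move=> wes xV yx /reach_uniq[q [xq qy qn uq]].
have q0 : q != [::] by apply: contraNneq yx => q0; rewrite -qy q0.
have [p1 [z [p2 [qE le]]]] := long_edge x q0.
have sq : size q = (size p1 + size p2).+1 by rewrite qE size_cat /= addnS.
have an : (size p1 < n)%N by apply: leq_trans qn; rewrite sq ltnS leq_addr.
have sub : {subset x :: q <= Vs}.
  by apply: path_edges_sub_vertices xV xq => e /wes; exact: esV.
exists (Ordinal an), (last x p1), z; split.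
- apply: sub; rewrite qE -cat_cons mem_cat; by rewrite mem_last.
- by apply: sub; rewrite qE in_cons mem_cat mem_head !orbT.
- by rewrite -qy; apply: leq_trans le _; rewrite leq_mul2r qn orbT.
- exists p1, p2; rewrite -qE; split => //; first by rewrite -qy qE last_cat.
  by split => //=; rewrite leq_subRL// addSn -sq.
Qed.

(** Sum [through_edge_prob] over the position and the endpoints of a longest
    edge of a path.  Its length is at least dist x y / n, which gives the factor
    n^s dist(x, y)^(- s); the sums over the endpoints decouple. *)
Lemma reach_prob_step n (M : nat -> R) x y : x \in Vs -> y \in Vs -> y != x ->
  (forall a v, (a < n)%N -> v \in Vs -> \sum_(u <- Vs) f a v u <= M a) ->
  f n x y <= b1 * n%:R `^ s * (\sum_(a < n) M a * M (n - a.+1)%N) * (dist x y)%:R `^ (- s).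
Proof.
move=> xV yV yx HS.
have s0 : 0 < s by case/andP: hs => h _; apply: le_lt_trans h.
have dxy0 : (0 < dist x y)%N by rewrite lt0n dist_eq0 eq_sym.
pose c (z z' : V) := (dist x y <= n * dist z z')%N.
pose G (a : nat) (z z' : V) w : R :=
  (c z z')%:R * indic R (through_edge a (n - a.+1)%N x z z' y w).
have G0 (a : nat) (z z' : V) w : 0 <= G a z z' w.
  by rewrite mulr_ge0//; case/andP: (indic01 R (through_edge a (n - a.+1)%N x z z' y w)).
apply: (@le_trans _ _ (Ebern p es (fun w =>
    \sum_(a < n) \sum_(z <- Vs) \sum_(z' <- Vs) G a z z' w))).
  apply: Ebern_le => // w wes.
  have [r|r] := pselect (reach w n x y); last first.
    by rewrite indicF//; do 3! (apply: sumr_ge0 => ? _).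
  rewrite indicT//.
  have [a [z [z' [zV z'V czz' thr]]]] := reach_through_long_edge wes xV yx r.
  have -> : 1 = G a z z' w by rewrite /G /c czz' indicT// mulr1.
  apply: le_trans (ler_term_sum (F := fun z' => G a z z' w) _ z'V) _ => //.
  apply: le_trans (ler_term_sum (F := fun z => \sum_(z' <- Vs) G a z z' w) _ zV) _ => //.
    by move=> ?; exact: sumr_ge0.
  apply: (ler_term_sum (F := fun a : 'I_n => \sum_(z <- Vs) \sum_(z' <- Vs) G a z z' w)).
    by move=> ?; apply: sumr_ge0 => ? _; exact: sumr_ge0.
  by rewrite mem_index_enum.
rewrite Ebern_sum; last exact: p01.
rewrite [leRHS]mulrAC mulr_sumr; apply: ler_sum => a _.
pose D := b1 * n%:R `^ s * (dist x y)%:R `^ (- s).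
have b10 : 0 <= b1 by move: b11; lra.
have D0 : 0 <= D.
  by apply: mulr_ge0; [apply: mulr_ge0 => //|]; exact: powR_ge0.
have f0 m (u v : V) : 0 <= f m u v by case/andP: (reach_prob01 p01 es m u v).
have Gle (z z' : V) : Ebern p es (G a z z') <= D * (f a x z * f (n - a.+1)%N y z').
  rewrite EbernZ; have [czz'|_] := boolP (c z z'); last first.
    by rewrite mul0r mulr_ge0// mulr_ge0.
  rewrite mul1r; apply: le_trans (through_edge_prob p01 _ _ _ _ _ _ ues) _.
  rewrite [leRHS]mulrCA; apply: ler_wpM2l => //.
  rewrite (reach_prob_sym p01 es _ z'); apply: ler_wpM2r => //.
  have zz'0 : (0 < dist z z')%N.
    by rewrite lt0n; apply: contraTneq czz' => z0; rewrite /c z0 muln0 -ltnNge.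
  apply: le_trans (pup _) _; first by rewrite -dist_eq0 -lt0n.
  rewrite /D -mulrA; apply: ler_wpM2l; first by lra.
  rewrite !powRN ler_pdivlMr ?powR_gt0 ?ltr0n// mulrC ler_pdivrMr ?powR_gt0 ?ltr0n//.
  rewrite -powRM ?ler0n//; apply: powR_le; rewrite ?ler0n ?(ltW s0)// -natrM ler_nat.
  exact: czz'.
apply: (@le_trans _ _ (\sum_(z <- Vs) \sum_(z' <- Vs) D * (f a x z * f (n - a.+1)%N y z'))).
  rewrite Ebern_sum; last exact: p01.
  apply: ler_sum => z _; rewrite Ebern_sum; last exact: p01.
  apply: ler_sum => z' _.
  exact: Gle.
have -> : \sum_(z <- Vs) \sum_(z' <- Vs) D * (f a x z * f (n - a.+1)%N y z') =
    D * ((\sum_(z <- Vs) f a x z) * (\sum_(z' <- Vs) f (n - a.+1)%N y z')).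
  rewrite mulr_suml mulr_sumr; apply: eq_bigr => z _.
  by rewrite mulr_sumr mulr_sumr.
apply: ler_wpM2l => //.
apply: ler_pM; rewrite ?sumr_ge0//; apply: HS => //.
by rewrite ltn_subrL /= (leq_ltn_trans (leq0n a) (ltn_ord a)).
Qed.

End Step.

Let al : R := d%:R / s.

(** Strong induction on [n]: [reach_prob_step] turns bounds exp (h a) on the
    expected ball sizes, for a < n, into f <= Kn dist^(-s) with
    C1 Kn^(d/s) = exp (h n), and [layer_sum] turns this back into the bound
    exp (h n) at [n]. *)
Theorem reach_prob_le (th : R) : 0 < th < 1 -> 2 `^ th = 2 * al ->
  exists2 K, 0 < K &
  forall (p : {fset V} -> R) (es : seq {fset V}) (Vs : seq V),
  (forall e, 0 <= p e <= 1) ->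
  (forall x y, x != y -> p [fset x; y]%fset <= b1 * (dist x y)%:R `^ (- s)) ->
  uniq es -> uniq Vs ->
  (forall e, e \in es -> forall v, v \in e -> v \in Vs) ->
  forall n x y, x \in Vs -> y \in Vs -> y != x ->
  reach_prob p es n x y <= expR (K * n.+1%:R `^ th) * (dist x y)%:R `^ (- s).
Proof.
move=> th01 thE; have /andP[ds s2d] := hs.
have d1 : 1 <= d%:R :> R by rewrite ler1n.
have s0 : 0 < s by lra.
have al0 : 0 < al by rewrite divr_gt0//; lra.
have al1 : 2^-1 < al < 1.
  rewrite /al ltr_pdivlMr// ltr_pdivrMr//; apply/andP; split; lra.
have [C1 C11 HC] := @layer_sum R d s d0 ds.
have lC : 0 <= ln C1 by exact: ln_ge0.
have lb : 0 <= ln b1 by exact: ln_ge0.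
pose A := ln C1 + al * ln b1; pose B := al * (s + 1).
have A0 : 0 <= A by rewrite addr_ge0// mulr_ge0// ltW.
have B0 : 0 <= B by apply: mulr_ge0; [exact: ltW|lra].
have [K [h [K0 hK hrec]]] := growth_function al1 th01 thE A0 B0.
exists (K / al); first by rewrite divr_gt0.
move=> p es Vs p01 pup ues uVs esV.
pose f := reach_prob p es.
have f01 n x y : 0 <= f n x y <= 1 := reach_prob01 p01 es n x y.
pose Kn n := expR ((h n - ln C1) / al).
have step n x y : x \in Vs -> y \in Vs -> y != x ->
  (forall a v, (a < n)%N -> v \in Vs -> \sum_(u <- Vs) f a v u <= expR (h a)) ->
  f n x y <= Kn n * (dist x y)%:R `^ (- s).
  move=> xV yV yx HS.
  apply: le_trans (reach_prob_step p01 pup ues esV xV yV yx HS) _.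
  apply: ler_wpM2r; first exact: powR_ge0.
  have [n0|n0] := posnP n; first by rewrite n0 big_ord0 mulr0 expR_ge0.
  have nR : 0 < n%:R :> R by rewrite ltr0n.
  pose X := expR ((h n - A - B * ln n%:R) / al).
  apply: (@le_trans _ _ (b1 * n%:R `^ s * (n%:R * X))).
    apply: ler_wpM2l; first by apply: mulr_ge0; [move: b11; lra|exact: powR_ge0].
    rewrite mulr_natl -[X in _ *+ X]card_ord -sumr_const; apply: ler_sum => a _.
    rewrite -expRD ler_expR ler_pdivlMr// mulrC.
    have := @hrec a (n - a.+1)%N n; have := ltn_ord a => an.
    rewrite -addSn subnKC//.
    move=> /(_ erefl); lra.
  rewrite mulrA -mulrA -[leLHS]mulrA.
  have b10 : 0 < b1 by move: b11; lra.
  rewrite -[X in X * _](lnK (_ : b1 \is Num.pos)) ?posrE//.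
  rewrite [X in _ * (X * _)](_ : _ = expR (s * ln n%:R)); last by rewrite /powR gt_eqF.
  rewrite -[X in _ * (_ * (X * _))](lnK (_ : n%:R \is Num.pos)) ?posrE//.
  rewrite -!expRD ler_expR /A /B; rewrite le_eqVlt; apply/orP; left; apply/eqP.
  by field; rewrite gt_eqF.
have sums n v : v \in Vs -> \sum_(u <- Vs) f n v u <= expR (h n).
  elim/ltn_ind: n v => n IH v vV.
  have [n0|n0] := posnP n.
    rewrite (bigD1_seq v)//= big1_seq ?addr0.
      apply: (@le_trans _ _ 1); first by case/andP: (f01 n v v).
      by rewrite -expR0 ler_expR; case/andP: (hK n).
    move=> u /andP[uv uV]; rewrite /f /reach_prob -(Ebern_cst p es 0).
    apply: Ebern_ext => // w _; rewrite indicF// => -[q [_ qu]].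
    rewrite n0 leqn0 size_eq0 => /eqP q0.
    by move: qu uv; rewrite q0 /= => ->; rewrite eqxx.
  have hn : ln C1 <= h n.
    have := hrec 0%N n.-1 n (prednK n0).
    have /andP[h0 _] := hK 0%N; have /andP[hn _] := hK n.-1.
    have : 0 <= B * ln n%:R by rewrite mulr_ge0// ln_ge0// ler1n.
    have : 0 <= al * (h 0%N + h n.-1) by rewrite mulr_ge0 ?(ltW al0)// addr_ge0.
    have : 0 <= al * ln b1 by rewrite mulr_ge0// ltW.
    by rewrite /A; lra.
  have Kn1 : 1 <= Kn n.
    by rewrite /Kn -expR0 ler_expR divr_ge0 ?(ltW al0)// subr_ge0.
  have := HC v Vs (fun u => if u \in Vs then f n v u else 0) (Kn n) uVs Kn1.
  rewrite -big_mkcond /= -big_seq => le.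
  apply: le_trans (le _ _) _.
  - by move=> u; case: ifP => _ //; rewrite lexx ler01.
  - move=> u uv; case: ifPn => uV; last by rewrite mulr_ge0 ?expR_ge0 ?powR_ge0.
    by apply: step => // a b an bV; exact: IH.
  have C10 : 0 < C1 by lra.
  rewrite -/al /Kn -expRM divfK ?gt_eqF// -{1}(lnK (_ : C1 \is Num.pos)) ?posrE//.
  by rewrite -expRD; rewrite le_eqVlt; apply/orP; left; apply/eqP; congr expR; ring.
move=> n x y xV yV yx; apply: le_trans (step n x y xV yV yx _) _.
  by move=> a v _; exact: sums.
apply: ler_wpM2r; first exact: powR_ge0.
rewrite ler_expR mulrAC ler_pM2r ?invr_gt0//.
by have /andP[_ h1] := hK n; lra.
Qed.

End LowerBound.

(** * Scales for the upper bound *)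

Section Scales.
Variables (R : realType) (g De : R).
Hypothesis (g01 : 0 < g < 1) (De0 : 0 < De) (gDe : g `^ De = 2^-1).

(** n^g, enlarged by the factor exp (sqrt (ln n)): so many pairs of points make
    the failure probability decay faster than every power of [n]. *)
Definition gap_size (n : nat) : nat :=
  Num.truncn (expR (g * ln n%:R + Num.sqrt (ln n%:R))).

(** A supersolution for the cost of a gap: the cost at scale [n] is at least
    twice the cost at scale [gap_size n], plus one for the long edge and [eta]
    for the possible failure.  In terms of u = ln n, a gap passes from u to
    v <= g u + sqrt u.  The shifted scale G u = u - B sqrt u satisfies
    G v <= g (G u) for large u once B (sqrt g - g) = 1, so the enlargement of the
    gaps is absorbed and K (G u)^De - (1 + eta) works, as g^De = 1/2. *)
Lemma scale_function (eta dd : R) : 0 <= eta -> 0 <= dd ->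
  exists K, exists n0, exists Phi : nat -> R, [/\ 0 < K,
    (forall m n, (m <= n)%N -> Phi m <= Phi n),
    (forall n, (n <= n0)%N -> dd * n%:R <= Phi n),
    (forall n, 0 <= Phi n <= K * Num.max 1 (ln n%:R) `^ De) &
    forall n, (n0 < n)%N -> [/\ (4 * gap_size n < n)%N,
      expR (g * ln n%:R + Num.sqrt (ln n%:R)) / 2 <= (gap_size n)%:R &
      2 * Phi (gap_size n) + 1 + eta <= Phi n]].
Proof.
move=> eta0 dd0; have /andP[g0 g1] := g01.
pose q := Num.sqrt g.
have q0 : 0 < q by rewrite sqrtr_gt0.
have qq : q * q = g by rewrite -expr2 sqr_sqrtr// ltW.
have q1 : q < 1 by rewrite -(sqrtr1 R) ltr_sqrt.
have gq : g < q by rewrite -qq gtr_pMr.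
pose B := (q - g)^-1.
have B0 : 0 < B by rewrite invr_gt0 subr_gt0.
have BE : B * q - 1 = B * g by rewrite /B; field; rewrite subr_eq0 gt_eqF.
(* Beyond u = Tt^2, that is n > n0, all lower order terms are negligible. *)
pose Tt := B + g^-1 + 4 / (1 - g) + 1.
have gi0 : 0 < g^-1 by rewrite invr_gt0.
have g4 : 0 < 4 / (1 - g) by rewrite divr_gt0//; lra.
have T1 : 1 <= Tt by rewrite /Tt; lra.
pose n0 := Num.truncn (expR (Tt * Tt)).
pose G u := Num.max 1 (u - B * Num.sqrt u) : R.
have G1 u : 1 <= G u by rewrite /G le_max lexx.
have lnn0 n : 0 <= ln n%:R :> R.
  by case: n => [|n]; [rewrite ln0|rewrite ln_ge0// ler1n].
have Gmono u v : 0 <= u -> u <= v -> G u <= G v.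
  move=> u0 uv; rewrite {1}/G ge_max G1/= /G le_max.
  have [h|h] := leP (u - B * Num.sqrt u) 1; first by [].
  apply/orP; right.
  have uu : Num.sqrt u * Num.sqrt u = u by rewrite -expr2 sqr_sqrtr.
  have vv : Num.sqrt v * Num.sqrt v = v by rewrite -expr2 sqr_sqrtr// (le_trans u0).
  have suv : Num.sqrt u <= Num.sqrt v by exact: ler_wsqrtr.
  have su0 : 0 <= Num.sqrt u by exact: sqrtr_ge0.
  have eu : u - B * Num.sqrt u = Num.sqrt u * (Num.sqrt u - B).
    by rewrite mulrBr uu (mulrC B).
  have ev : v - B * Num.sqrt v = Num.sqrt v * (Num.sqrt v - B).
    by rewrite mulrBr vv (mulrC B).
  rewrite eu ev in h *; apply: ler_pM => //; last by rewrite lerD2r.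
  rewrite subr_ge0 leNgt; apply/negP => h2; move: h.
  rewrite ltNge => /negP; apply; apply: (@le_trans _ _ 0) => //.
  by rewrite mulr_ge0_le0// subr_le0 ltW.
have GK u : 0 <= u -> G u <= Num.max 1 u.
  move=> u0; rewrite /G ge_max !le_max lexx /=; apply/orP; right.
  by rewrite gerBl mulr_ge0 ?sqrtr_ge0 ?ltW.
pose K := dd * n0%:R + 1 + eta.
have K0 : 0 < K by rewrite /K; have := mulr_ge0 dd0 (ler0n R n0); lra.
pose Phi (n : nat) := K * G (ln n%:R) `^ De - (1 + eta).
have GDe1 n : 1 <= G (ln n%:R) `^ De.
  by have := ler_powR (G1 (ln n%:R)) (ltW De0); rewrite powRr0.
have Phi_ge n : dd * n0%:R <= Phi n.
  have : K * 1 <= K * G (ln n%:R) `^ De by rewrite ler_pM2l.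
  by rewrite /Phi {1}/K; lra.
exists K, n0, Phi; split; first exact: K0.
- move=> m n mn; rewrite /Phi lerD2r ler_pM2l//; apply: powR_le; first exact: ltW.
    exact: le_trans (G1 _).
  apply: Gmono => //; case: m mn => [|m] mn; first by rewrite ln0.
  by rewrite ler_ln ?posrE ?ltr0n ?(leq_trans _ mn)// ler_nat.
- by move=> n nn0; apply: le_trans (Phi_ge n); rewrite ler_wpM2l// ler_nat.
- move=> n; apply/andP; split.
    by apply: le_trans (Phi_ge n); rewrite mulr_ge0.
  apply: (@le_trans _ _ (K * G (ln n%:R) `^ De)); first by rewrite /Phi; lra.
  rewrite ler_pM2l//; apply: powR_le; [exact: ltW|exact: le_trans (G1 _)|exact: GK].
move=> n n0n; set u := ln n%:R; set t := expR (g * u + Num.sqrt u).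
have nR0 : 0 < n%:R :> R by rewrite ltr0n (leq_ltn_trans _ n0n).
have uT : Tt * Tt <= u.
  rewrite -ler_expR /u lnK ?posrE//; apply: ltW.
  apply: lt_le_trans (truncnS_gt _) _; by rewrite ler_nat.
have TT0 : 0 <= Tt by lra.
have u0 : 0 <= u by exact: lnn0.
have su : Tt <= Num.sqrt u.
  by rewrite -(ger0_norm TT0) -sqrtr_sqr expr2; exact: ler_wsqrtr.
have uu : Num.sqrt u * Num.sqrt u = u by rewrite -expr2 sqr_sqrtr.
have s1 : 1 <= Num.sqrt u by lra.
have e2 : 2 <= expR (Num.sqrt u) by have := expR_ge1Dx (Num.sqrt u); lra.
have eg1 : 1 <= expR (g * u) by rewrite -expR0 ler_expR mulr_ge0// ltW.
have t2 : 2 * expR (g * u) <= t by rewrite /t expRD mulrC ler_pM2l ?expR_gt0.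
have t0 : 0 <= t by exact: expR_ge0.
have mt : (gap_size n)%:R <= t by rewrite /gap_size -/u -/t truncn_le.
have tm : t < (gap_size n)%:R + 1 by rewrite natr1 /gap_size -/u -/t truncnS_gt.
have tm2 : t / 2 <= (gap_size n)%:R by rewrite ler_pdivrMr//; lra.
split => //.
- rewrite -(ltr_nat R) natrM; apply: (@le_lt_trans _ _ (4 * t)); first by lra.
  have : 1 + 3 < expR 3 :> R by rewrite expR_gt1Dx.
  have -> : (1 + 3 = 4 :> R) by lra.
  move=> h; apply: (@lt_le_trans _ _ (expR 3 * t)); first by rewrite ltr_pM2r// expR_gt0.
  rewrite /t -expRD -(lnK nR0) ler_expR -/u.
  have h1 : 3 <= Num.sqrt u * ((1 - g) * Num.sqrt u - 1).
    have h2 : 3 <= (1 - g) * Num.sqrt u - 1.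
      have : (1 - g) * Tt <= (1 - g) * Num.sqrt u by rewrite ler_wpM2l//; lra.
      have : 4 <= (1 - g) * Tt.
        rewrite mulrC -ler_pdivrMr; last by lra.
        by rewrite /Tt; lra.
      lra.
    by rewrite -[leLHS]mul1r; apply: ler_pM => //; lra.
  by rewrite -[X in _ <= X]uu; rewrite -[X in g * X]uu; lra.
- set m := gap_size n; set v : R := ln m%:R.
  have egm : expR (g * u) <= m%:R by lra.
  have m0 : 0 < m%:R :> R by apply: lt_le_trans egm; exact: expR_gt0.
  have vl : g * u <= v by rewrite /v -ler_expR lnK ?posrE.
  have vu : v <= g * u + Num.sqrt u by rewrite /v -ler_expR lnK ?posrE.
  have sv : q * Num.sqrt u <= Num.sqrt v.
    by rewrite /q -sqrtrM ?(ltW g0)//; exact: ler_wsqrtr.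
  have Gv : G v <= g * G u.
    have h1 : g * (u - B * Num.sqrt u) <= g * G u.
      by rewrite ler_pM2l// /G le_max lexx orbT.
    apply: le_trans h1; rewrite {1}/G ge_max; apply/andP; split.
      rewrite -ler_pdivrMl// mulr1 -[X in X - _]uu -mulrBl.
      rewrite -[leLHS]mulr1; apply: ler_pM => //; [exact: ltW|].
      by rewrite /Tt in su; lra.
    have h2 : B * (q * Num.sqrt u) <= B * Num.sqrt v by rewrite ler_pM2l.
    have h3 : (B * q - 1) * Num.sqrt u = B * g * Num.sqrt u by rewrite BE.
    lra.
  have h1 : G v `^ De <= 2^-1 * G u `^ De.
    rewrite -gDe -powRM ?(ltW g0) ?(le_trans _ (G1 u))//.
    by apply: powR_le => //; [exact: ltW|exact: le_trans (G1 v)].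
  have h2 : K * (G v `^ De) <= K * (2^-1 * G u `^ De) by rewrite ler_pM2l.
  by rewrite /Phi -/v -/u; lra.
Qed.

End Scales.

Section FailureBounds.
Variables (R : realType).

Lemma expR_le_1D2x (t : R) : 0 <= t <= 2^-1 -> expR t - 1 <= 2 * t.
Proof.
move=> /andP[t0 t1]; have h := expR_ge1Dx (- t); rewrite expRN in h.
have e0 := expR_gt0 t.
have : (1 - t) * expR t <= 1 by rewrite -ler_pdivlMr// div1r.
have : 0 <= (2^-1 - t) * (t * 2) by rewrite mulr_ge0//; lra.
move=> h1 h2; have : (1 - t) * expR t <= (1 - t) * (1 + 2 * t) by lra.
rewrite ler_pM2l; lra.
Qed.

(** There are at least m^(2d) candidate edges, of length at most 2 n, so the
    exponent is at least a multiple of n^(-s) m^(2d), hence of exp (2 sqrt u)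
    and of u^2, where u = ln n; and - c u^2 <= 4 / c - 4 u. *)
Lemma failure_le (d : nat) (s b2 : R) : (0 < d)%N -> 0 < s -> 0 < b2 ->
  exists2 eta, 0 < eta & forall n m : nat, (0 < n)%N ->
    expR (s / (2 * d%:R) * ln n%:R + Num.sqrt (ln n%:R)) / 2 <= m%:R ->
    expR (- (b2 * (2 * n%:R) `^ (- s) * m%:R ^+ (2 * d))) <= eta / n%:R ^+ 4.
Proof.
move=> d0 s0 b20.
pose c := b2 * 2 `^ (- s) * 2^-1 ^+ (2 * d) * (2 / 3).
have c0 : 0 < c by rewrite !mulr_gt0 ?powR_gt0 ?exprn_gt0.
exists (expR (4 / c)); first exact: expR_gt0.
move=> n m n0; set u := ln n%:R; set t := expR _ => tm.
have nR : 0 < n%:R :> R by rewrite ltr0n.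
have dR : 1 <= d%:R :> R by rewrite ler1n.
have u0 : 0 <= u by rewrite ln_ge0// ler1n.
have nE : n%:R = expR u by rewrite lnK ?posrE.
have uu : Num.sqrt u ^+ 2 = u by rewrite sqr_sqrtr.
have su0 : 0 <= Num.sqrt u by exact: sqrtr_ge0.
have tE : t ^+ (2 * d) = expR (s * u) * expR ((2 * d%:R) * Num.sqrt u).
  rewrite /t -expRM_natl -expRD natrM; congr expR; field; lra.
have e2 : 2 / 3 * u ^+ 2 <= expR ((2 * d%:R) * Num.sqrt u).
  have su20 : 0 <= 2 * Num.sqrt u by exact: mulr_ge0.
  have := @expR_ge1Dxn R (2 * Num.sqrt u) 3 su20.
  have -> : (2 * Num.sqrt u) ^+ 4 / 4`!%:R = 2 / 3 * u ^+ 2.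
    by rewrite -[in RHS]uu /factorial /=; field.
  have : expR (2 * Num.sqrt u) <= expR (2 * d%:R * Num.sqrt u).
    rewrite ler_expR ler_wpM2r//; lra.
  lra.
have mE : 2^-1 ^+ (2 * d) * t ^+ (2 * d) <= m%:R ^+ (2 * d).
  rewrite -exprMn mulrC; apply: lerXn2r => //; rewrite nnegrE ?ler0n//.
  by apply: divr_ge0 => //; exact: expR_ge0.
have h1 : c * u ^+ 2 <= b2 * (2 * n%:R) `^ (- s) * m%:R ^+ (2 * d).
  apply: (@le_trans _ _
      (b2 * (2 * n%:R) `^ (- s) * (2^-1 ^+ (2 * d) * t ^+ (2 * d)))); last first.
    apply: ler_wpM2l; last exact: mE.
    by apply: mulr_ge0; [exact: ltW|exact: powR_ge0].
  rewrite tE powRM ?ler0n// [in X in _ <= X]nE -expRM mulrN expRN.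
  have -> : b2 * (2 `^ (- s) / expR (u * s)) *
      (2^-1 ^+ (2 * d) * (expR (s * u) * expR (2 * d%:R * Num.sqrt u))) =
      b2 * 2 `^ (- s) * 2^-1 ^+ (2 * d) * expR (2 * d%:R * Num.sqrt u).
    by rewrite (mulrC s u); field; rewrite expR_eq0.
  rewrite /c -mulrA; apply: ler_wpM2l => //.
  apply: mulr_ge0; last exact: exprn_ge0.
  by apply: mulr_ge0; [exact: ltW|exact: powR_ge0].
apply: (@le_trans _ _ (expR (- (c * u ^+ 2)))); first by rewrite ler_expR lerN2.
rewrite nE -expRM_natl -expRB ler_expR.
have : 0 <= c * (u - 2 / c) ^+ 2 by rewrite mulr_ge0 ?sqr_ge0// ltW.
have -> : c * (u - 2 / c) ^+ 2 = c * u ^+ 2 - 4 * u + 4 / c by field; rewrite gt_eqF.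
lra.
Qed.

(** After a failure the gap costs at most min (d n, L) steps.  When la d n <= 1/2
    the exponential is linearized.  Otherwise [n] is at least of order sqrt L, so
    that the failure probability, of order n^(-4), beats the largest possible
    value exp (la L) = L divided by la. *)
Lemma failure_cost_le (d n L : nat) (eta fl : R) : (0 < d)%N -> (0 < n)%N ->
  expR 1 <= L%:R :> R -> 0 < eta -> 0 <= fl -> fl <= eta / n%:R ^+ 4 ->
  fl * (expR (ln L%:R / L%:R * (minn (d * n) L)%:R) - 1) <=
  ln L%:R / L%:R * (256 * d%:R ^+ 4 * eta).
Proof.
move=> d0 n0 L1 eta0 fl0 fle.
have nR : 1 <= n%:R :> R by rewrite ler1n.
have dR : 1 <= d%:R :> R by rewrite ler1n.
have LR : 0 < L%:R :> R by apply: lt_le_trans L1; exact: expR_gt0.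
have lL : 1 <= ln L%:R :> R by rewrite -ler_expR lnK ?posrE.
set la := ln L%:R / L%:R.
have la0 : 0 < la by rewrite divr_gt0//; lra.
have n4 : 0 < n%:R ^+ 4 :> R by rewrite exprn_gt0//; lra.
have d4 : 1 <= d%:R ^+ 4 :> R by rewrite exprn_ege1.
have [h|h] := leP (la * (d%:R * n%:R)) 2^-1.
  set t := la * (minn (d * n) L)%:R.
  have t0 : 0 <= t by rewrite mulr_ge0// ltW.
  have tle : t <= la * (d%:R * n%:R) by rewrite ler_pM2l// -natrM ler_nat geq_minl.
  have h1 : expR t - 1 <= 2 * (la * (d%:R * n%:R)).
    apply: le_trans (expR_le_1D2x _) _; last by lra.
    by rewrite t0 (le_trans tle).
  apply: (@le_trans _ _ (eta / n%:R ^+ 4 * (2 * (la * (d%:R * n%:R))))).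
    apply: ler_pM => //; rewrite subr_ge0 -expR0 ler_expR//.
  have -> : eta / n%:R ^+ 4 * (2 * (la * (d%:R * n%:R))) =
      la * (2 * d%:R * eta * (n%:R^-1 ^+ 3)).
    by field; lra.
  rewrite ler_pM2l//.
  have n3 : n%:R^-1 ^+ 3 <= 1 :> R by rewrite exprn_ile1 ?invr_ge0 ?invf_le1//; lra.
  apply: (@le_trans _ _ (2 * d%:R * eta)).
    by rewrite ler_piMr// !mulr_ge0 ?ltW//; lra.
  rewrite ler_pM2r//.
  have : d%:R <= d%:R ^+ 4 :> R by rewrite -[leLHS]expr1 ler_weXn2l.
  lra.
have Ls : ln L%:R <= 2 * Num.sqrt L%:R :> R.
  have half0 : 0 < 2^-1 :> R by rewrite invr_gt0.
  by have := ln_le_powR half0 LR; rewrite invrK powR12_sqrt ?(ltW LR)// mulrC.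
have ss : Num.sqrt L%:R * Num.sqrt L%:R = L%:R :> R by rewrite -expr2 sqr_sqrtr// ltW.
have s0 : 0 < Num.sqrt L%:R :> R by rewrite sqrtr_gt0.
have h1 : Num.sqrt L%:R <= 4 * (d%:R * n%:R) :> R.
  have : L%:R * 2^-1 <= ln L%:R * (d%:R * n%:R) :> R.
    have := ltW h; rewrite /la -(ler_pM2l LR) => /le_trans; apply.
    by rewrite mulrCA mulrA divfK ?gt_eqF.
  have : ln L%:R * (d%:R * n%:R) <= 2 * Num.sqrt L%:R * (d%:R * n%:R) :> R.
    by rewrite ler_wpM2r// mulr_ge0; lra.
  move=> a b.
  have : Num.sqrt L%:R * (Num.sqrt L%:R * 2^-1) <=
      Num.sqrt L%:R * (2 * (d%:R * n%:R)) :> R.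
    rewrite mulrA ss; lra.
  rewrite ler_pM2l//; lra.
have LL : L%:R * L%:R <= 256 * (d%:R ^+ 4 * n%:R ^+ 4) :> R.
  pose X : R := 4 * (d%:R * n%:R).
  have s0' := ltW s0.
  have LX : L%:R <= X * X by rewrite -ss; apply: ler_pM.
  have L0' := ltW LR.
  apply: (@le_trans _ _ (X * X * (X * X))); first by apply: ler_pM.
  by rewrite le_eqVlt; apply/orP; left; apply/eqP; rewrite /X; ring.
have h2 : expR (la * (minn (d * n) L)%:R) <= L%:R :> R.
  rewrite -[leRHS](lnK (_ : _ \is Num.pos)) ?posrE// ler_expR.
  have -> : ln L%:R = la * L%:R :> R by rewrite /la divfK// gt_eqF.
  by rewrite ler_pM2l// ler_nat geq_minr.
apply: (@le_trans _ _ (eta / n%:R ^+ 4 * L%:R)).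
  apply: ler_pM => //; last by lra.
  by rewrite subr_ge0 -expR0 ler_expR mulr_ge0// ltW.
rewrite mulrAC ler_pdivrMr// /la.
rewrite -(ler_pM2r LR).
apply: (@le_trans _ _ (eta * (256 * (d%:R ^+ 4 * n%:R ^+ 4)))).
  by rewrite -mulrA ler_pM2l.
have -> : ln L%:R / L%:R * (256 * d%:R ^+ 4 * eta) * n%:R ^+ 4 * L%:R =
  ln L%:R * (eta * (256 * (d%:R ^+ 4 * n%:R ^+ 4))) :> R by field; lra.
apply: ler_peMl; last exact: lL.
apply: mulr_ge0; first exact: ltW.
apply: mulr_ge0; first exact: ler0n.
by apply: mulr_ge0; [exact: le_trans d4|exact: ltW].
Qed.

End FailureBounds.

(** * The exponential moment of the capped distance *)

Section TwoGaps.
Variables (R : realType) (I : choiceType) (p : I -> R).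
Hypothesis p01 : forall e, 0 <= p e <= 1.

Lemma Ebern_set0 es : Ebern p es (fun w => indic R (w = set0)) = \prod_(e <- es) (1 - p e).
Proof.
elim: es => [|e es IH] /=; first by rewrite big_nil indicT.
rewrite big_cons IH (_ : Ebern _ _ _ = 0) ?mulr0 ?add0r//.
rewrite -[RHS](Ebern_cst p es); apply: Ebern_ext => // w _; rewrite indicF//.
by move=> /seteqP[/(_ e) h _]; apply: h; left.
Qed.

(** One round of the hierarchical construction, without geometry: [cs] are the
    candidate long edges, [bx] and [by_] the edges near the two endpoints.  If
    some candidate [e] is open, [F] is at most a product of functions of the
    independent configurations on [bx] and [by_]; otherwise only the bound [b]
    is available, and this happens with probability the product of the
    1 - p e. *)
Lemma Ebern_two_gaps (es cs bx by_ : seq I) (F : set I -> R) (a b c : R) :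
  uniq es -> uniq cs -> uniq bx -> uniq by_ ->
  {subset cs <= es} -> {subset bx <= es} -> {subset by_ <= es} ->
  (forall e, e \in bx -> e \notin cs) ->
  (forall e, e \in by_ -> e \notin cs /\ e \notin bx) ->
  0 <= c -> (forall w, F w <= b) ->
  (forall e, e \in cs -> exists fx fy : set I -> R,
    [/\ forall w w1 w2, w e -> w1 `<=` w -> w2 `<=` w -> F w <= c * (fx w1 * fy w2) &
        c * (Ebern p bx fx * Ebern p by_ fy) <= a]) ->
  Ebern p es F <= a + (\prod_(e <- cs) (1 - p e)) * (b - a).
Proof.
move=> ues ucs ubx uby csE bxE byE bxcs bycs c0 Fb Fe.
pose rest := [seq e <- es | e \notin cs ++ (bx ++ by_)].
have pes : perm_eq es (cs ++ (bx ++ (by_ ++ rest))).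
  apply: uniq_perm => //.
    rewrite !cat_uniq ucs ubx uby filter_uniq//= !andbT.
    apply/and3P; split.
    - apply/hasPn => e; rewrite !mem_cat => /or3P[/bxcs//|/bycs[]//|].
      by rewrite mem_filter mem_cat negb_or => /andP[/andP[]].
    - apply/hasPn => e; rewrite mem_cat => /orP[/bycs[]//|].
      by rewrite mem_filter !mem_cat !negb_or => /andP[/and3P[]].
    - apply/hasPn => e; rewrite mem_filter !mem_cat !negb_or.
      by move=> /andP[/and3P[]].
  move=> e; rewrite !mem_cat mem_filter !mem_cat !negb_or.
  apply/idP/idP => [->|/or4P[/csE//|/bxE//|/byE//|/andP[]//]].
  by case: (e \in cs); case: (e \in bx); case: (e \in by_).
rewrite (Ebern_perm p F pes) (Ebern_cat p01).
have key w0 : w0 `<=` [set` cs] ->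
    Ebern p (bx ++ (by_ ++ rest)) (fun w => F (w0 `|` w)) <=
    a + (b - a) * indic R (w0 = set0).
  move=> w0cs; have [w00|/eqP/set0P[e w0e]] := pselect (w0 = set0).
    rewrite indicT// mulr1 subrKC -[leRHS](Ebern_cst p (bx ++ (by_ ++ rest))).
    by apply: Ebern_le => // w _.
  rewrite indicF ?mulr0 ?addr0; last by move=> w00; rewrite w00 in w0e.
  have [fx [fy [Fle le]]] := Fe e (w0cs _ w0e).
  apply: le_trans le; rewrite (Ebern_cat p01).
  apply: (@le_trans _ _
      (Ebern p bx (fun w1 => Ebern p by_ (fun w2 => c * (fx w1 * fy w2))))).
    apply: Ebern_le => // w1 _; rewrite (Ebern_cat p01); apply: Ebern_le => // w2 _.
    rewrite -[leRHS](Ebern_cst p rest); apply: Ebern_le => // w3 _.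
    apply: Fle; [by left|by move=> x; right; left|by move=> x; right; right; left].
  rewrite le_eqVlt; apply/orP; left; apply/eqP.
  have -> : (fun w1 => Ebern p by_ (fun w2 => c * (fx w1 * fy w2))) =
      (fun w1 => c * Ebern p by_ fy * fx w1).
    by apply/funext => w1; rewrite !EbernZ; ring.
  by rewrite EbernZ; ring.
apply: le_trans (Ebern_le p01 key) _.
by rewrite EbernD// Ebern_cst EbernZ// Ebern_set0 mulrC.
Qed.

End TwoGaps.

Section UpperBound.
Variables (R : realType) (d : nat) (s b2 : R).
Local Notation V := 'rV[int]_d.
Hypothesis (d0 : (0 < d)%N) (hs : d%:R < s < 2 * d%:R) (b20 : 0 < b2).

(** The nearest-neighbour edges are added to every configuration: they
    belong to every realization of the graph, and with them the number of steps
    between two points is at most d times their distance. *)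
Definition nn_hops (L : nat) (w : set {fset V}) (x y : V) : nat :=
  hops L (w `|` @nn_edges d) x y.

(** The empty set is excluded because it would lie inside every ball, while
    edges near different endpoints must be different. *)
Definition inside (x : V) (k : nat) (e : {fset V}) : bool :=
  (e != fset0) && all (fun v => dist x v <= k)%N (enum_fset e).

Lemma insideP x k e v : inside x k e -> v \in e -> (dist x v <= k)%N.
Proof. by move=> /andP[_ /allP h] ve; exact: h. Qed.

Lemma inside2 x k a b : inside x k [fset a; b]%fset =
  (dist x a <= k)%N && (dist x b <= k)%N.
Proof.
apply/idP/andP.
  by move=> h; split; apply: (insideP h); rewrite !inE eqxx ?orbT.
move=> [xa xb]; apply/andP; split.
  by apply/fset0Pn; exists a; rewrite !inE eqxx.
apply/allP => v; rewrite -[v \in _]/(v \in [fset a; b]%fset) !inE.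
by move=> /orP[/eqP ->|/eqP ->].
Qed.

Lemma prod_le_exp (es : seq {fset V}) (p : {fset V} -> R) (q : R) :
  (forall e, 0 <= p e <= 1) -> (forall e, e \in es -> 1 - p e <= q) ->
  0 <= \prod_(e <- es) (1 - p e) <= q ^+ size es.
Proof.
move=> p01; elim: es => [|e es IH] h; first by rewrite big_nil expr0 ler01 lexx.
have /andP[p0 p1] := p01 e.
have /IH/andP[h1 h2] : forall f, f \in es -> 1 - p f <= q.
  by move=> f fe; apply: h; rewrite in_cons fe orbT.
have q0 : 0 <= 1 - p e by rewrite subr_ge0.
rewrite big_cons /= exprS mulr_ge0//= ler_pM//.
by apply: h; rewrite mem_head.
Qed.

Section OneScale.
Variables (p : {fset V} -> R) (L : nat) (la : R).
Hypothesis p01 : forall e, 0 <= p e <= 1.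
Hypothesis plow : forall x y, x != y ->
  1 - p [fset x; y]%fset <= expR (- (b2 * (dist x y)%:R `^ (- s))).
Hypothesis la0 : 0 < la.

Definition hop_moment es x y := Ebern p es (fun w => expR (la * (nn_hops L w x y)%:R)).

(** The bounds hold for every list of edges rich enough around [x], because the
    sub-gaps see only the edges that are left to them. *)
Definition contains_box (es : seq {fset V}) (x : V) (k : nat) :=
  forall a b, a != b -> (dist x a <= k)%N -> (dist x b <= k)%N -> [fset a; b]%fset \in es.

Lemma nn_hops_le w x y : (nn_hops L w x y <= minn (d * dist x y) L)%N.
Proof.
rewrite leq_min hops_leL andbT; apply/hops_le/reach_nn => e; by right.
Qed.

Lemma hop_moment_nn es x y :
  hop_moment es x y <= expR (la * (minn (d * dist x y) L)%:R).
Proof.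
rewrite -[leRHS](Ebern_cst p es); apply: Ebern_le => // w _.
by rewrite ler_expR ler_pM2l// ler_nat nn_hops_le.
Qed.

(** The candidates are the edges between the balls of radius [m] around [x] and
    [y].  A gap from [x] to a point of the first ball is bridged inside the ball
    of radius 2 m, and likewise at [y]; since 4 m < n, these balls are disjoint
    and contain no candidate. *)
Lemma hop_moment_step n m (Phim : R) es x y :
  dist x y = n -> (4 * m < n)%N -> uniq es -> contains_box es x (2 * n) ->
  0 <= Phim ->
  (forall u v es', (dist u v <= m)%N -> uniq es' ->
     contains_box es' u (2 * dist u v) -> hop_moment es' u v <= expR (la * Phim)) ->
  hop_moment es x y <= expR (la * (2 * Phim + 1)) +
    expR (- (b2 * (2 * n%:R) `^ (- s) * m%:R ^+ (2 * d))) *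
      (expR (la * (minn (d * n) L)%:R) - 1).
Proof.
move=> dxy mn ues ces P0 IH.
have n0 : (0 < n)%N by apply: leq_ltn_trans mn.
pose cs := [seq [fset z; z']%fset | z <- box x m, z' <- box y m].
pose bx := [seq e <- es | inside x (2 * m) e].
pose by_ := [seq e <- es | inside y (2 * m) e].
have xm z : z \in box x m -> (dist x z <= m)%N by rewrite mem_box.
have ym z : z \in box y m -> (dist y z <= m)%N by rewrite mem_box.
have far z z' : (dist x z <= 2 * m)%N -> (dist y z' <= 2 * m)%N -> z != z'.
  move=> xz yz; apply/eqP => zz'.
  have := dist_triangle z x y; rewrite dxy (dist_sym z y) zz' => h.
  move: mn; rewrite ltnNge (leq_trans h)//.
  by rewrite (_ : 4 * m = 2 * m + 2 * m)%N ?leq_add -?mulnDl// -zz'.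
have m2 : (m <= 2 * m)%N by rewrite leq_pmull.
have xm2 z : z \in box x m -> (dist x z <= 2 * m)%N by move/xm/leq_trans; apply.
have ym2 z : z \in box y m -> (dist y z <= 2 * m)%N by move/ym/leq_trans; apply.
have ucs : uniq cs.
  apply: allpairs_uniq; rewrite ?uniq_box// => -[z z'] [u u'].
  move=> /allpairsP[[z1 z1'] /= [z1x z1y [-> ->]]].
  move=> /allpairsP[[u1 u1'] /= [u1x u1y [-> ->]]] /= E.
  congr pair.
    have : z1 \in [fset u1; u1']%fset by rewrite -E !inE eqxx.
    rewrite !inE => /orP[/eqP//|/eqP h].
    by have := far z1 u1' (xm2 _ z1x) (ym2 _ u1y); rewrite h eqxx.
  have : z1' \in [fset u1; u1']%fset by rewrite -E !inE eqxx orbT.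
  rewrite !inE => /orP[/eqP h|/eqP//].
  by have := far u1 z1' (xm2 _ u1x) (ym2 _ z1y); rewrite h eqxx.
have mn' : (2 * m <= n)%N.
  by apply: leq_trans (ltnW mn); rewrite leq_mul2r orbT.
have y2n z : (dist y z <= 2 * m)%N -> (dist x z <= 2 * n)%N.
  move=> h; apply: leq_trans (dist_triangle y x z) _.
  by rewrite dxy mul2n -addnn leq_add2l (leq_trans h).
have x2n z : (dist x z <= 2 * m)%N -> (dist x z <= 2 * n)%N.
  by move=> h; apply: leq_trans h _; rewrite (leq_trans mn')// leq_pmull.
have csE : {subset cs <= es}.
  move=> e /allpairsP[[z z'] /= [zx zy ->]]; apply: ces.
  - exact: far (xm2 _ zx) (ym2 _ zy).
  - exact: x2n (xm2 _ zx).
  - exact: y2n (ym2 _ zy).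
have bxcs e : e \in bx -> e \notin cs.
  rewrite mem_filter => /andP[ein _]; apply/negP => /allpairsP[[z z'] /= [zx zy eE]].
  move: ein; rewrite eE inside2 => /andP[_ h].
  by have := far z' z' h (ym2 _ zy); rewrite eqxx.
have bycs e : e \in by_ -> e \notin cs /\ e \notin bx.
  rewrite mem_filter => /andP[ein _]; split.
    apply/negP => /allpairsP[[z z'] /= [zx zy eE]].
    move: ein; rewrite eE inside2 => /andP[h _].
    by have := far z z (xm2 _ zx) h; rewrite eqxx.
  apply/negP; rewrite mem_filter => /andP[ein' _].
  have /andP[/fset0Pn[v ve] _] := ein.
  by have := far v v (insideP ein' ve) (insideP ein ve); rewrite eqxx.
pose A := expR (la * (2 * Phim + 1)); pose B := expR (la * (minn (d * n) L)%:R).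
have A1 : 1 <= A by rewrite -expR0 ler_expR mulr_ge0 ?(ltW la0)//; lra.
have bxE : {subset bx <= es} by move=> e; rewrite mem_filter => /andP[].
have byE : {subset by_ <= es} by move=> e; rewrite mem_filter => /andP[].
have main : hop_moment es x y <= A + (\prod_(e <- cs) (1 - p e)) * (B - A).
  apply: (Ebern_two_gaps p01 ues ucs (filter_uniq _ ues) (filter_uniq _ ues)
    csE bxE byE bxcs bycs (expR_ge0 la)).
    by move=> w; rewrite ler_expR ler_pM2l// ler_nat -dxy nn_hops_le.
  move=> e /allpairsP[[z z'] /= [zx zy ->]].
  exists (fun w1 => expR (la * (nn_hops L w1 x z)%:R)),
    (fun w2 => expR (la * (nn_hops L w2 y z')%:R)).
  split.
    move=> w w1 w2 we w1w w2w; rewrite -!expRD ler_expR.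
    rewrite -[X in X + _]mulr1 -!mulrDr ler_pM2l// -natrD nat1r ler_nat.
    have h1 : (nn_hops L w x z <= nn_hops L w1 x z)%N by apply: hops_mono; exact: setSU.
    have h2 : (nn_hops L w y z' <= nn_hops L w2 y z')%N by apply: hops_mono; exact: setSU.
    have h3 : (nn_hops L w z z' <= 1)%N by apply/hops_le/reach_edge; left.
    apply: leq_trans (hops_trans L _ x z y) _.
    rewrite -addnS; apply: leq_add => //.
    apply: leq_trans (hops_trans L _ z z' y) _.
    rewrite -(add1n (nn_hops L w2 y z')); apply: leq_add => //.
    by rewrite hops_sym.
  have i1 : hop_moment bx x z <= expR (la * Phim).
    apply: IH; [exact: xm|exact: filter_uniq|].
    have le2 : (2 * dist x z <= 2 * m)%N by rewrite leq_mul2l xm.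
    move=> u v uv xu xv; rewrite mem_filter inside2 !(leq_trans _ le2)//=.
    by apply: ces => //; apply: x2n; exact: leq_trans le2.
  have i2 : hop_moment by_ y z' <= expR (la * Phim).
    apply: IH; [exact: ym|exact: filter_uniq|].
    have le2 : (2 * dist y z' <= 2 * m)%N by rewrite leq_mul2l ym.
    move=> u v uv xu xv; rewrite mem_filter inside2 !(leq_trans _ le2)//=.
    by apply: ces => //; apply: y2n; exact: leq_trans le2.
  have -> : A = expR la * (expR (la * Phim) * expR (la * Phim)).
    by rewrite -!expRD; congr expR; ring.
  rewrite ler_pM2l ?expR_gt0//; apply: ler_pM => //;
    by apply: Ebern_ge0 => // w _; exact: expR_ge0.
apply: le_trans main _; rewrite lerD2l.
pose q := expR (- (b2 * (2 * n%:R) `^ (- s))).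
have s0 : 0 < s by case/andP: hs => h _; apply: le_lt_trans h.
have qcs e : e \in cs -> 1 - p e <= q.
  move=> /allpairsP[[z z'] /= [zx zy ->]].
  have zz' := far _ _ (xm2 _ zx) (ym2 _ zy).
  apply: le_trans (plow zz') _; rewrite ler_expR lerN2 ler_pM2l//.
  apply: powRN_le; [exact: ltW|by rewrite ltr0n lt0n dist_eq0|].
  have zz2 : (dist z z' <= m + (n + m))%N.
    apply: leq_trans (dist_triangle x z z') _.
    rewrite dist_sym; apply: leq_add; first exact: xm.
    apply: leq_trans (dist_triangle y x z') _.
    by rewrite dxy leq_add2l; exact: ym.
  rewrite -natrM ler_nat; apply: leq_trans zz2 _.
  by rewrite addnCA mul2n -addnn leq_add2l addnn -mul2n.
have /andP[pr0 prq] := prod_le_exp p01 qcs.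
have szcs : (m ^ (2 * d) <= size cs)%N.
  rewrite /cs size_allpairs !size_box -expnD addnn -mul2n leq_exp2r ?muln_gt0//.
  by rewrite addn1 (leq_trans m2).
have q01 : 0 <= q <= 1.
  by rewrite expR_ge0 expR_le1 oppr_le0 mulr_ge0 ?powR_ge0// ltW.
have qm : \prod_(e <- cs) (1 - p e) <=
    expR (- (b2 * (2 * n%:R) `^ (- s) * m%:R ^+ (2 * d))).
  apply: le_trans prq _; rewrite -mulNr -natrX expRM_natr.
  by apply: ler_wiXn2l => //; case/andP: q01.
have B1 : 1 <= B by rewrite -expR0 ler_expR mulr_ge0// ltW.
apply: (@le_trans _ _ (\prod_(e <- cs) (1 - p e) * (B - 1))).
  by apply: ler_wpM2l; rewrite ?lerD2l ?lerN2.
by apply: ler_wpM2r => //; rewrite subr_ge0.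
Qed.

End OneScale.

(** Strong induction on the distance of the endpoints.  The term la eta for the
    failure is absorbed by 1 + la eta <= exp (la eta). *)
Theorem hop_moment_bound : exists2 K : R, 0 < K &
  forall (p : {fset V} -> R) (L : nat),
  (forall e, 0 <= p e <= 1) ->
  (forall x y, x != y ->
     1 - p [fset x; y]%fset <= expR (- (b2 * (dist x y)%:R `^ (- s)))) ->
  expR 1 <= L%:R :> R ->
  forall x y es, uniq es -> contains_box es x (2 * dist x y) ->
  hop_moment p L (ln L%:R / L%:R) es x y <=
    expR (ln L%:R / L%:R * (K * Num.max 1 (ln (dist x y)%:R) `^ lrp_Delta d s)).
Proof.
have /andP[ds s2d] := hs.
have d1 : 1 <= d%:R :> R by rewrite ler1n.
have s0 : 0 < s by lra.
have g01 : 0 < lrp_gamma d s < 1.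
  by rewrite /lrp_gamma divr_gt0 ?ltr_pdivrMr/= ?mul1r//; lra.
have /andP[g0 g1] := g01.
have lg : 0 < ln (1 / lrp_gamma d s).
  by rewrite ln_gt0// div1r invf_gt1.
have l2 : 0 < ln (2 : R) by rewrite ln_gt0// ltr1n.
have De0 : 0 < lrp_Delta d s by rewrite /lrp_Delta divr_gt0// /log2 divr_gt0.
have gDe : lrp_gamma d s `^ lrp_Delta d s = 2^-1.
  rewrite /powR gt_eqF// /lrp_Delta /log2 div1r invf_div.
  rewrite div1r lnV ?posrE//.
  have lgN : ln (lrp_gamma d s) != 0 by rewrite lt_eqF// ln_lt0.
  rewrite (_ : _ * _ = - ln 2); last by field.
  by rewrite expRN lnK ?posrE.
have [eta1 eta10 Hfail] := @failure_le R d s b2 d0 s0 b20.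
pose eta := 256 * d%:R ^+ 4 * eta1.
have eta0 : 0 <= eta.
  apply: mulr_ge0; last exact: ltW.
  by apply: mulr_ge0; [exact: ler0n|exact: exprn_ge0].
have [K [n0 [Phi [K0 Pmono Pbase PK Pstep]]]] :=
  scale_function g01 De0 gDe eta0 (ler0n R d).
exists K => // p L p01 plow L1 x y es ues ces.
have LR : 0 < L%:R :> R by apply: lt_le_trans L1; exact: expR_gt0.
have lL : 1 <= ln L%:R :> R by rewrite -ler_expR lnK ?posrE.
set la := ln L%:R / L%:R.
have la0 : 0 < la by rewrite divr_gt0//; lra.
apply: (@le_trans _ _ (expR (la * Phi (dist x y)))); last first.
  by rewrite ler_expR ler_pM2l//; case/andP: (PK (dist x y)).
move e : (dist x y) => n; elim/ltn_ind: n x y e es ues ces => n IH x y dxy es ues ces.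
have [nn0|n0n] := leqP n n0.
  apply: le_trans (hop_moment_nn _ p01 la0 es x y) _.
  rewrite ler_expR ler_pM2l// dxy; apply: le_trans (Pbase n nn0).
  by rewrite -natrM ler_nat geq_minl.
have [m4 mlow Pm] := Pstep n n0n; set m := gap_size _ _ in m4 mlow Pm.
have np : (0 < n)%N by apply: leq_ltn_trans n0n.
rewrite dxy in ces.
have /andP[Pm0 _] := PK m.
have mn : (m < n)%N by apply: leq_ltn_trans m4; rewrite leq_pmull.
apply: le_trans (hop_moment_step p01 plow la0 dxy m4 ues ces Pm0 _) _.
  move=> u v es' uv ues' ces'; apply: (@le_trans _ _ (expR (la * Phi (dist u v)))).
    by apply: IH ues' ces' => //; exact: leq_ltn_trans mn.
  by rewrite ler_expR ler_pM2l//; exact: Pmono.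
have h := failure_cost_le d0 np L1 eta10 (expR_ge0 _) (Hfail n m np mlow).
apply: (@le_trans _ _ (expR (la * (2 * Phi m + 1)) + la * eta)).
  by rewrite lerD2l; apply: le_trans h _; rewrite /la /eta.
apply: (@le_trans _ _ (expR (la * (2 * Phi m + 1)) * (1 + la * eta))).
  rewrite [leRHS]mulrDr mulr1 lerD2l.
  apply: ler_peMl; first by apply: mulr_ge0 => //; exact: ltW.
  rewrite -expR0 ler_expR; apply: mulr_ge0; first exact: ltW.
  by apply: addr_ge0 => //; exact: mulr_ge0.
apply: (@le_trans _ _ (expR (la * (2 * Phi m + 1)) * expR (la * eta))).
  by rewrite ler_pM2l ?expR_gt0// expR_ge1Dx.
by rewrite -expRD ler_expR -mulrDr ler_pM2l.
Qed.

End UpperBound.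

(** * Bounds for the random graph *)

Section GraphDist.
Variables (R : realType) (V : choiceType) (E : set {fset V}) (x y : V).

Lemma graph_dist_le_reach n : reach E n x y -> (graph_dist R E x y <= n%:R%:E)%E.
Proof.
move=> [p [xp py pn]].
apply: (@le_trans _ _ (size p)%:R%:E); last by rewrite lee_fin ler_nat.
by apply: ereal_inf_lbound; exists p.
Qed.

Lemma graph_dist_lt_reach (a : R) : (graph_dist R E x y < a%:E)%E ->
  exists2 n : nat, n%:R < a & reach E n x y.
Proof.
move=> /ereal_inf_lt[_ [p [xp py] <-]]; rewrite lte_fin => pa.
by exists (size p) => //; exists p.
Qed.

Lemma graph_dist_leP (b : R) : 0 <= b ->
  (graph_dist R E x y <= b%:E)%E <-> reach E (Num.truncn b) x y.
Proof.
move=> b0; split => [h|/graph_dist_le_reach h].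
  have /graph_dist_lt_reach[n nb] : (graph_dist R E x y < (Num.truncn b).+1%:R%:E)%E.
    by apply: le_lt_trans h _; rewrite lte_fin truncnS_gt.
  by move: nb; rewrite ltr_nat ltnS => nb; exact: reach_le.
by apply: le_trans h _; rewrite lee_fin truncn_le.
Qed.

Lemma graph_dist_geP (a : R) :
  (a%:E <= graph_dist R E x y)%E <-> (forall n : nat, n%:R < a -> ~ reach E n x y).
Proof.
split => [h n na /graph_dist_le_reach r|h].
  by have := le_trans h r; rewrite lee_fin leNgt na.
by rewrite leNgt; apply/negP => /graph_dist_lt_reach[n na]; exact: h.
Qed.

End GraphDist.

Section Percolation.
Variables (R : realType) (d : nat) (N : 'rV[R]_d -> R) (beta s : R).
Local Notation V := 'rV[int]_d.
Hypothesis (hd : (1 <= d)%N) (hN : is_norm N) (hbeta : 0 < beta) (s0 : 0 < s).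
Variables (disp : measure_display) (T : measurableType disp)
  (P : probability T R) (G : T -> set {fset V}).
Hypothesis lrp : long_range_percolation N beta s P G.

Definition edge_prob (e : {fset V}) : R := fine (P [set w | G w e]).

Lemma edge_prob01 e : 0 <= edge_prob e <= 1.
Proof.
have m := lrp_measurable lrp e.
rewrite /edge_prob fine_ge0 ?measure_ge0//= -lee_fin fineK ?fin_num_measure//.
exact: probability_le1.
Qed.

Lemma edge_prob_nn x y : nearest_neighbor x y -> edge_prob [fset x; y]%fset = 1.
Proof.
move=> nn; rewrite /edge_prob (_ : [set w | _] = setT) ?probability_setT//.
by apply/seteqP; split => // w _; exact: (lrp_nearest lrp _ nn).
Qed.

Lemma edge_prob_long x y : x != y -> ~~ nearest_neighbor x y ->
  edge_prob [fset x; y]%fset = connection_prob N beta s x y.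
Proof. by move=> xy nn; rewrite /edge_prob (lrp_prob lrp). Qed.

Lemma nearest_neighbor_dist (x y : V) : nearest_neighbor x y -> (dist x y <= 1)%N.
Proof.
move=> /eqP nn; apply/dist_leP => i; rewrite -lez_nat abszE.
rewrite -[leRHS]/(1 : int) -nn (bigD1 i)//=.
by rewrite lerDl sumr_ge0.
Qed.

Lemma edge_prob_le c : 0 < c -> (forall v, c * `|v| <= N v) ->
  forall x y, x != y -> edge_prob [fset x; y]%fset <=
    Num.max 1 (beta * c `^ (- s)) * (dist x y)%:R `^ (- s).
Proof.
move=> c0 Nc x y xy; have d0 : (0 < dist x y)%N by rewrite lt0n dist_eq0.
have [nn|nn] := boolP (nearest_neighbor x y).
  have -> : dist x y = 1%N.
    by apply/eqP; rewrite eqn_leq nearest_neighbor_dist.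
  by rewrite powR1 mulr1 edge_prob_nn// le_max lexx.
rewrite edge_prob_long// /connection_prob.
have Nd := Nc (embedZ R x - embedZ R y); rewrite (embed_sup_norm R hd) in Nd.
apply: (@le_trans _ _ (beta * N (embedZ R x - embedZ R y) `^ (- s))).
  by have := expR_ge1Dx (- (beta * N (embedZ R x - embedZ R y) `^ (- s))); lra.
apply: (@le_trans _ _ (beta * c `^ (- s) * (dist x y)%:R `^ (- s))).
  rewrite -mulrA ler_pM2l// -powRM ?ler0n ?(ltW c0)//; apply: powRN_le => //.
    exact: ltW.
  by rewrite mulr_gt0// ltr0n.
by apply: ler_wpM2r; rewrite ?powR_ge0// le_max lexx orbT.
Qed.

Lemma edge_prob_ge c : 0 < c -> (forall v, N v <= c * `|v|) ->
  forall x y, x != y -> 1 - edge_prob [fset x; y]%fset <=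
    expR (- (beta * c `^ (- s) * (dist x y)%:R `^ (- s))).
Proof.
move=> c0 Nc x y xy; have d0 : (0 < dist x y)%N by rewrite lt0n dist_eq0.
have [nn|nn] := boolP (nearest_neighbor x y).
  by rewrite edge_prob_nn// subrr expR_ge0.
rewrite edge_prob_long// /connection_prob subKr ler_expR lerN2.
have Nd := Nc (embedZ R x - embedZ R y); rewrite (embed_sup_norm R hd) in Nd.
rewrite -mulrA ler_pM2l// -powRM ?ler0n ?(ltW c0)//.
apply: powRN_le => //; first exact: ltW.
rewrite lt_neqAle is_norm_ge0// andbT eq_sym; apply/eqP => /(norm_definite hN) e0.
have := embed_sup_norm R hd x y; rewrite e0 normr0 => /esym/eqP.
by rewrite pnatr_eq0 -leqn0 leqNgt d0.
Qed.

(** A list of distinct edges that exhausts all edges as [k] grows; a finite path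
    lies in one of these boxes ([reach_box]). *)
Definition box_edges k : seq {fset V} :=
  undup [seq e : {fset V} <-
           [seq [fset a; b]%fset | a <- box (0 : V) k, b <- box (0 : V) k] |
           #|` e| == 2%N].

Lemma mem_box_edges k (a b : V) : a != b ->
  (dist (0%R : V) a <= k)%N -> (dist (0%R : V) b <= k)%N ->
  [fset a; b]%fset \in box_edges k.
Proof.
move=> ab ak bk; rewrite mem_undup mem_filter cardfs2 ab /=.
by apply/allpairsP; exists (a, b); rewrite /= !mem_box.
Qed.

Lemma box_edges_vertex k e v : e \in box_edges k -> v \in e -> v \in box 0 k.
Proof.
rewrite mem_undup mem_filter => /andP[_ /allpairsP[[a b] /= [ak bk ->]]].
by rewrite !inE => /orP[/eqP ->|/eqP ->].
Qed.

Lemma box_edges_card k : [set` box_edges k] `<=` [set e : {fset V} | #|` e| = 2%N].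
Proof. by move=> e /=; rewrite mem_undup mem_filter => /andP[/eqP]. Qed.

Definition box_graph k w : set {fset V} := [set e | G w e /\ e \in box_edges k].

Let mG e : measurable [set w | G w e]. Proof. exact: lrp_measurable lrp e. Qed.

Lemma measurable_box_graph k (Q : set {fset V} -> Prop) :
  measurable [set w | Q (box_graph k w)].
Proof. exact: (measurable_cfg mG). Qed.

Lemma prob_box_graph k (Q : set {fset V} -> Prop) :
  P [set w | Q (box_graph k w)] =
  (Ebern edge_prob (box_edges k) (fun w => indic R (Q w)))%:E.
Proof.
exact: (prob_cfg mG (lrp_independent lrp) _ (undup_uniq _) (@box_edges_card k)).
Qed.

Lemma box_edges_mono k l : (k <= l)%N -> {subset box_edges k <= box_edges l}.
Proof.
move=> kl e; rewrite !mem_undup !mem_filter => /andP[-> /allpairsP[[a b] /= [ak bk ->]]] /=.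
apply/allpairsP; exists (a, b); move: ak bk; rewrite /= !mem_box.
by move=> /leq_trans ak /leq_trans bk; rewrite ak// bk.
Qed.

Lemma reach_box n x :
  [set w | reach (G w) n 0%R x] = \bigcup_k [set w | reach (box_graph k w) n 0 x].
Proof.
apply/seteqP; split => w /=; last first.
  by move=> [k _]; apply: reach_le => // e [].
move=> [p [/path_edgesP p0 px pn]].
exists (\max_(v <- (0%R : V) :: p) dist (0%R : V) v)%N => //=; exists p; split => //.
apply/path_edgesP => e ep; have Gwe := p0 _ ep; split => //.
have e2 := lrp_simple lrp Gwe.
have [a [b eE]] := path_edges_fset2 ep.
have ab : a != b by move: e2; rewrite eE cardfs2; case: (a != b).
rewrite eE; apply: mem_box_edges => //.
  by apply: leq_bigmax_seq => //; apply: (path_edges_sub ep); rewrite eE !inE eqxx.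
by apply: leq_bigmax_seq => //; apply: (path_edges_sub ep); rewrite eE !inE eqxx orbT.
Qed.

Lemma measurable_reach n x : measurable [set w | reach (G w) n 0%R x].
Proof.
rewrite reach_box; apply: bigcupT_measurable => k.
exact: (measurable_box_graph k (fun E => reach E n 0 x)).
Qed.

(** Continuity from below along the boxes. *)
Lemma prob_reach_le n x (b : R) :
  (forall k, x \in box 0 k -> reach_prob edge_prob (box_edges k) n 0 x <= b) ->
  (P [set w | reach (G w) n 0%R x] <= b%:E)%E.
Proof.
move=> H; rewrite reach_box.
have mF k : measurable [set w | reach (box_graph k w) n 0 x].
  exact: (measurable_box_graph k (fun E => reach E n 0 x)).
have ndF : nondecreasing_seq (fun k => [set w | reach (box_graph k w) n 0 x]).
  move=> k l kl; apply/subsetPset => w /=; apply: reach_le => // e [Ge ek].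
  by split => //; exact: box_edges_mono ek.
have cv := @nondecreasing_cvg_mu _ _ _ P _ mF (bigcupT_measurable _ mF) ndF.
rewrite -(cvg_lim _ cv)//; apply: lime_le; first by apply/cvg_ex; eexists; exact: cv.
near=> k.
have := prob_box_graph k (fun E => reach E n 0 x) => /= ->; rewrite lee_fin; apply: H.
rewrite mem_box; near: k; exact: nbhs_infty_ge.
Unshelve. all: by end_near.
Qed.

(** The Markov inequality for the exponential moment in a single finite box;
    further edges can only decrease the distance. *)
Lemma prob_not_reach_le L x (la b : R) : 0 <= la ->
  hop_moment edge_prob L la (box_edges (2 * dist (0%R : V) x)) 0 x <= b ->
  (P [set w | ~ reach (G w) L 0%R x] <= (expR (- (la * L%:R)) * b)%:E)%E.
Proof.
move=> la0 Hb; set k := (2 * dist (0%R : V) x)%N in Hb.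
apply: (@le_trans _ _ (P [set w | (L <= nn_hops L (box_graph k w) 0%R x)%N])).
  apply: le_measure; rewrite ?inE.
  - rewrite (_ : [set w | _] = ~` [set w | reach (G w) L 0%R x])//.
    by apply: measurableC; exact: measurable_reach.
  - exact: (measurable_box_graph k (fun E => (L <= nn_hops L E 0%R x)%N)).
  - move=> w /= nr; rewrite leqNgt; apply/negP => h; apply: nr.
    have := hopsP h; apply: reach_le; last exact: hops_leL.
    move=> e [[]//|[a [b' [nn ->]]]]; exact: (lrp_nearest lrp _ nn).
have -> := prob_box_graph k (fun E => (L <= nn_hops L E 0%R x)%N).
rewrite lee_fin; apply: (@le_trans _ _ (expR (- (la * L%:R)) *
    hop_moment edge_prob L la (box_edges k) 0 x)); last first.
  by apply: ler_wpM2l => //; exact: expR_ge0.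
rewrite /hop_moment -EbernZ; apply: Ebern_le; first exact: edge_prob01.
move=> w _; rewrite -expRD; have [h|h] := pselect (L <= nn_hops L w 0%R x)%N.
  rewrite indicT// -[leLHS]expR0 ler_expR addrC subr_ge0.
  by apply: ler_wpM2l; rewrite ?ler_nat.
by rewrite indicF// expR_ge0.
Qed.

Lemma measurable_dist_between x (a b : R) : 0 <= b ->
  measurable [set w | (a%:E <= graph_dist R (G w) 0%R x <= b%:E)%E].
Proof.
move=> b0.
rewrite (_ : [set w | _] = (~` \bigcup_(m in [set m : nat | m%:R < a])
    [set w | reach (G w) m 0%R x]) `&` [set w | reach (G w) (Num.truncn b) 0%R x]).
  apply: measurableI; last exact: measurable_reach.
  apply: measurableC; apply: bigcup_measurable => m _; exact: measurable_reach.
apply/seteqP; split => w /=.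
  move=> /andP[/graph_dist_geP h1 /(graph_dist_leP _ _ _ b0) h2]; split => //.
  by move=> [m mc mr]; exact: h1 mr.
move=> [h1 h2]; apply/andP; split; last exact/graph_dist_leP.
by apply/graph_dist_geP => m mc mr; apply: h1; exists m.
Qed.

Lemma prob_not_between_le x (a b : R) : 0 <= a -> 0 <= b ->
  (P (~` [set w | (a%:E <= graph_dist R (G w) 0%R x <= b%:E)%E]) <=
   P [set w | reach (G w) (Num.truncn a) 0%R x] +
   P [set w | ~ reach (G w) (Num.truncn b) 0%R x])%E.
Proof.
move=> a0 b0; have mnr : measurable [set w | ~ reach (G w) (Num.truncn b) 0%R x].
  by apply: measurableC; exact: measurable_reach.
have mr := measurable_reach (Num.truncn a) x.
apply: le_trans (measureU2 _ mr mnr); apply: le_measure; rewrite ?inE.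
- by apply: measurableC; exact: measurable_dist_between.
- exact: measurableU.
move=> w; apply: contra_notP => /not_orP[/= nr /contrapT r].
apply/andP; split; last exact/graph_dist_leP.
apply/graph_dist_geP => m mc mr'; apply: nr; apply: reach_le mr' => //.
by rewrite truncn_ge_nat// ltW.
Qed.

End Percolation.

(** * Rates and conclusion *)

Section Rates.
Variable R : realType.

(** With n + 1 at most 2 c l^De and (2 c)^(1/De) = s / (2 K), the exponential
    growth term is at most exp (s l / 2), half of the decay exp (- s l). *)
Lemma lower_rate (K s De c2 l rho : R) (n : nat) :
  0 < K -> 0 < s -> 0 < De -> 0 < c2 -> 0 < l -> 0 < rho ->
  1 <= (s / (2 * K)) `^ De / 2 * l `^ De ->
  n%:R <= (s / (2 * K)) `^ De / 2 * l `^ De ->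
  expR l <= c2 * rho ->
  expR (K * n.+1%:R `^ De^-1) * rho `^ (- s) <= c2 `^ s * expR (- (s / 2 * l)).
Proof.
move=> K0 s0 De0 c20 l0 rho0 big1 nle rle.
set a := s / (2 * K) in big1 nle.
have a0 : 0 < a by rewrite divr_gt0// mulr_gt0.
have n1 : n.+1%:R <= a `^ De * l `^ De by rewrite -natr1; lra.
have h1 : K * n.+1%:R `^ De^-1 <= s / 2 * l.
  apply: (@le_trans _ _ (K * (a `^ De * l `^ De) `^ De^-1)).
    rewrite ler_pM2l//; apply: powR_le => //; by rewrite invr_ge0 ltW.
  rewrite powRM ?powR_ge0// -!powRrM mulfV ?gt_eqF// !powRr1 ?(ltW a0) ?(ltW l0)//.
  rewrite /a le_eqVlt; apply/orP; left; apply/eqP; field; by rewrite gt_eqF.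
have h2 : rho `^ (- s) <= c2 `^ s * expR (- (s * l)).
  apply: (@le_trans _ _ ((expR l / c2) `^ (- s))).
    apply: powRN_le; [exact: ltW|by rewrite divr_gt0// expR_gt0|].
    by rewrite ler_pdivrMr// mulrC.
  have ci : c2^-1 `^ (- s) = c2 `^ s.
    by rewrite -powR_inv1 ?(ltW c20)// -powRrM mulN1r opprK.
  by rewrite powRM ?expR_ge0 ?invr_ge0 ?(ltW c20)// ci -expRM mulrN (mulrC l) [leLHS]mulrC.
apply: (@le_trans _ _ (expR (s / 2 * l) * (c2 `^ s * expR (- (s * l))))).
  by apply: ler_pM; rewrite ?expR_ge0 ?powR_ge0// ler_expR.
rewrite mulrCA -expRD; apply: ler_wpM2l; first exact: powR_ge0.
by rewrite ler_expR; lra.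
Qed.

(** The factor 4 in [C] makes the exponent of the moment at most ln L / 2, half
    of the gain ln L of the Markov inequality. *)
Lemma upper_rate (K De c1 l : R) (rho : nat) (C := 4 * K * 2 `^ De)
    (L := Num.truncn (C * l `^ De)) :
  0 < K -> 0 < De -> 0 < c1 -> 1 <= l -> - ln c1 <= l -> (0 < rho)%N ->
  c1 * rho%:R <= expR l -> 2 <= C * l `^ De ->
  expR (- (ln L%:R / L%:R * L%:R)) *
    expR (ln L%:R / L%:R * (K * Num.max 1 (ln rho%:R) `^ De)) <=
  expR (- (ln (C * l `^ De / 2) / 2)).
Proof.
move=> K0 De0 c10 l1 lc1 rho0 rle big2.
have l0 : 0 < l by lra.
have X0 : 0 <= C * l `^ De by lra.
have rho0' : 0 < rho%:R :> R by rewrite ltr0n.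
have LX : C * l `^ De / 2 <= L%:R.
  have := truncnS_gt (C * l `^ De); rewrite -/L -natr1 => h.
  by rewrite ler_pdivrMr//; lra.
have L1 : 1 <= L%:R :> R by apply: le_trans LX; rewrite ler_pdivlMr// mul1r.
have L0 : 0 < L%:R :> R by lra.
have lL0 : 0 <= ln L%:R :> R by rewrite ln_ge0.
have lrho : ln rho%:R <= 2 * l.
  have : ln (c1 * rho%:R) <= l.
    by rewrite -[leRHS]expRK ler_ln ?posrE ?expR_gt0 ?mulr_gt0.
  rewrite lnM ?posrE//; lra.
have max2 : Num.max 1 (ln rho%:R) <= 2 * l.
  by rewrite ge_max lrho andbT; lra.
have h1 : K * Num.max 1 (ln rho%:R) `^ De <= L%:R / 2.
  apply: (@le_trans _ _ (K * (2 * l) `^ De)).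
    rewrite ler_pM2l//; apply: powR_le => //; first exact: ltW.
    by rewrite le_max ler01.
  have h2 : K * (2 * l) `^ De = C * l `^ De / 4.
    by rewrite powRM ?(ltW l0)// /C; field.
  rewrite h2; lra.
rewrite -expRD ler_expR.
apply: (@le_trans _ _ (- (ln L%:R / 2))).
  have h2 : ln L%:R / L%:R * (K * Num.max 1 (ln rho%:R) `^ De) <=
      ln L%:R / L%:R * (L%:R / 2).
    by apply: ler_wpM2l => //; rewrite divr_ge0// ltW.
  have h3 : ln L%:R / L%:R * (L%:R / 2) = ln L%:R / 2 :> R by field; rewrite gt_eqF.
  have h4 : ln L%:R / L%:R * L%:R = ln L%:R :> R by field; rewrite gt_eqF.
  rewrite h4; lra.
rewrite lerN2 ler_pM2r// ler_ln ?posrE//; lra.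
Qed.

End Rates.

Section Filters.
Variables (R : realType) (d : nat) (N : 'rV[R]_d -> R).

Lemma near_ln_norm (M : R) : \forall x \near norm_infty N, M <= ln (N (embedZ R x)).
Proof.
exists (expR M) => //= x /= /ltW h.
by rewrite -[leLHS]expRK ler_ln ?posrE ?expR_gt0// (lt_le_trans _ h)// expR_gt0.
Qed.

Lemma near_ln_norm_powR (M De : R) : 0 < De ->
  \forall x \near norm_infty N, M <= ln (N (embedZ R x)) `^ De.
Proof.
move=> De0; near=> x.
have [M0|M0] := leP M 0; first exact: le_trans (powR_ge0 _ _).
have h : M `^ De^-1 <= ln (N (embedZ R x)) by near: x; exact: near_ln_norm.
rewrite -[leLHS](powRr1 (ltW M0)) -(mulVf (_ : De != 0)) ?gt_eqF// powRrM.
by apply: powR_le => //; [exact: ltW|exact: powR_ge0].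
Unshelve. all: by end_near.
Qed.

End Filters.

Theorem theorem1p1 (R : realType) (d : nat) (N : 'rV[R]_d -> R) (beta s : R)
    (hd : (1 <= d)%N) (hN : is_norm N) (hbeta : 0 < beta)
    (hs : d%:R < s < 2 * d%:R) :
  exists c C : R, [/\ 0 < c, 0 < C &
    forall (disp : measure_display) (T : measurableType disp)
      (P : probability T R) (G : T -> set {fset 'rV[int]_d}),
      long_range_percolation N beta s P G ->
      P [set w |
          ((c * ln (N (embedZ R x)) `^ lrp_Delta d s)%:E
             <= graph_dist R (G w) 0%R x
             <= (C * ln (N (embedZ R x)) `^ lrp_Delta d s)%:E)%E]
        @[x --> norm_infty N] --> 1%E].
Proof.
have [c2 c20 Nc2] := is_norm_le_sup hN; have [c1 c10 Nc1] := is_norm_ge_sup hd hN.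
have /andP[ds s2d] := hs.
have d1 : 1 <= d%:R :> R by rewrite ler1n.
have s0 : 0 < s by lra.
pose g := lrp_gamma d s.
have g0 : 0 < g by rewrite /g /lrp_gamma divr_gt0//; lra.
have g12 : 2^-1 < g < 1.
  by rewrite /g /lrp_gamma ltr_pdivrMr ?ltr_pdivlMr; [apply/andP; split|..]; lra.
have l2 : 0 < ln (2 : R) by rewrite ln_gt0// ltr1n.
have lg : 0 < ln (1 / g) by rewrite ln_gt0// div1r invf_gt1//; case/andP: g12.
pose De := lrp_Delta d s.
have DeE : De = ln 2 / ln (1 / g) by rewrite /De /lrp_Delta /log2 div1r invf_div.
have De0 : 0 < De by rewrite DeE divr_gt0.
(* 2^(1/Delta) = 1/gamma = 2d/s: the relation between exponent and recursion. *)
have thE : 2 `^ De^-1 = 2 * (d%:R / s).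
  rewrite /powR pnatr_eq0 /= DeE invf_div divfK ?gt_eqF//.
  rewrite lnK; last by rewrite posrE divr_gt0.
  by rewrite /g /lrp_gamma; field; rewrite !gt_eqF//; lra.
have th01 : 0 < De^-1 < 1.
  have lg2 : ln (1 / g) < ln 2.
    rewrite ltr_ln; [|by rewrite posrE divr_gt0|by rewrite posrE].
    by rewrite ltr_pdivrMr//; case/andP: g12; lra.
  by rewrite invr_gt0 De0 DeE invf_div ltr_pdivrMr// [ltRHS]mul1r.
pose b1 := Num.max 1 (beta * c1 `^ (- s)).
have b11 : 1 <= b1 by rewrite le_max lexx.
pose b2 := beta * c2 `^ (- s).
have b20 : 0 < b2 by rewrite mulr_gt0// powR_gt0.
have [K1 K10 HK1] := reach_prob_le hd hs b11 th01 thE.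
have [K2 K20 HK2] := hop_moment_bound hd hs b20.
pose c := (s / (2 * K1)) `^ De / 2.
pose C := 4 * K2 * 2 `^ De.
have c0 : 0 < c by rewrite divr_gt0// powR_gt0// divr_gt0// mulr_gt0.
have C0 : 0 < C by rewrite mulr_gt0 ?powR_gt0// mulr_gt0.
exists c, C; split => // disp T P G lrp.
pose E x := [set w | ((c * ln (N (embedZ R x)) `^ De)%:E <= graph_dist R (G w) 0%R x
             <= (C * ln (N (embedZ R x)) `^ De)%:E)%E].
have Ndist (x : 'rV[int]_d) : c1 * (dist 0 x)%:R <= N (embedZ R x) <= c2 * (dist 0 x)%:R.
  have e0 : embedZ R x - embedZ R 0 = embedZ R x.
    by apply/rowP => i; rewrite !mxE subr0.
  by rewrite dist_sym -(embed_sup_norm R hd) e0 Nc1 Nc2.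
have pl := edge_prob_le hd hbeta s0 lrp; have ph := edge_prob_ge hd hN hbeta s0 lrp.
have p01 := edge_prob01 lrp.
have key x (l := ln (N (embedZ R x))) : 1 <= l -> - ln c1 <= l ->
    c^-1 <= l `^ De -> 2 * expR 1 / C <= l `^ De ->
    (P (~` E x) <= (c2 `^ s * expR (- (s / 2 * l)) +
      expR (- (ln (C * l `^ De / 2) / 2)))%:E)%E.
  move=> l1 lc1 lc lC.
  have l0 : 0 < l by lra.
  have Np : 0 < N (embedZ R x).
    rewrite ltNge; apply/negP => h; move: l0; rewrite /l ln0// ltxx.
    by [].
  have elN : expR l = N (embedZ R x) by rewrite /l lnK ?posrE.
  have /andP[Nge Nle] := Ndist x.
  have rho0 : (0 < dist 0%R x)%N.
    by rewrite lt0n; apply: contraTneq Np => r0; rewrite r0 mulr0 in Nle; rewrite -leNgt.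
  have x0 : x != 0 by rewrite eq_sym -dist_eq0 -lt0n.
  have cl1 : 1 <= c * l `^ De by rewrite -ler_pdivrMl// mulr1.
  have e2 : 2 <= expR 1 :> R by have := expR_ge1Dx (1 : R); lra.
  have Cl : 2 * expR 1 <= C * l `^ De by rewrite -ler_pdivrMl// mulrC.
  have Cl2 : 2 <= C * l `^ De by lra.
  pose n := Num.truncn (c * l `^ De); pose L := Num.truncn (C * l `^ De).
  have cl0 : 0 <= c * l `^ De by lra.
  have Cl0 : 0 <= C * l `^ De by lra.
  apply: le_trans (prob_not_between_le lrp x cl0 Cl0) _.
  rewrite EFinD; apply: leeD.
    apply: (@le_trans _ _
        (expR (K1 * n.+1%:R `^ De^-1) * (dist 0%R x)%:R `^ (- s))%:E); last first.
      rewrite lee_fin; apply: lower_rate => //; rewrite ?ltr0n//.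
        by rewrite truncn_le.
      by rewrite elN.
    apply: (prob_reach_le lrp) => k xk.
    apply: (HK1 _ _ (box 0 k) p01 (pl _ c10 Nc1)) => //.
    - exact: undup_uniq.
    - exact: uniq_box.
    - by move=> e ek v; exact: box_edges_vertex.
    - by rewrite mem_box dist_refl.
  have LX : expR 1 <= L%:R :> R.
    have := truncnS_gt (C * l `^ De); rewrite -/L -natr1; lra.
  have L0 : 0 < L%:R :> R by lra.
  have la0 : 0 <= ln L%:R / L%:R :> R.
    by rewrite divr_ge0 ?(ltW L0)// ln_ge0//; lra.
  apply: le_trans (prob_not_reach_le lrp la0 (HK2 _ L p01 _ LX 0 x _ _ _)) _.
  - exact: ph c20 Nc2.
  - exact: undup_uniq.
  - by move=> a b ab ak bk; exact: mem_box_edges.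
  rewrite lee_fin; apply: (@upper_rate R K2 De c1 l (dist 0%R x)) => //.
  by rewrite elN.
have mE x : measurable (E x).
  by apply: (measurable_dist_between lrp); rewrite mulr_ge0 ?powR_ge0// ltW.
apply/fine_cvgP; split.
  by apply: nearW => x; apply: fin_num_measure; exact: mE.
apply/(@cvgrPdist_le _ _ _ _ (norm_infty_filter N)) => e e0.
near=> x; set l := ln (N (embedZ R x)).
have l1 : 1 <= l by rewrite /l; near: x; exact: near_ln_norm.
have lc1 : - ln c1 <= l by rewrite /l; near: x; exact: near_ln_norm.
have lc : c^-1 <= l `^ De by rewrite /l; near: x; apply: near_ln_norm_powR.
have lC : 2 * expR 1 / C <= l `^ De by rewrite /l; near: x; apply: near_ln_norm_powR.
have lA : - (ln (e / 2 / c2 `^ s)) * (2 / s) <= l.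
  by rewrite /l; near: x; exact: near_ln_norm.
have lB : expR (- (2 * ln (e / 2))) * 2 / C <= l `^ De.
  by rewrite /l; near: x; apply: near_ln_norm_powR.
have e20 : 0 < e / 2 by rewrite divr_gt0.
have c2s : 0 < c2 `^ s by exact: powR_gt0.
have bA : c2 `^ s * expR (- (s / 2 * l)) <= e / 2.
  rewrite -ler_pdivlMl// [leRHS]mulrC -[leRHS](lnK (_ : _ \is Num.pos)) ?posrE ?divr_gt0//.
  rewrite ler_expR; move: lA; rewrite -ler_pdivlMr ?divr_gt0// invf_div.
  have -> : l * (s / 2) = s / 2 * l by rewrite mulrC.
  lra.
have bB : expR (- (ln (C * l `^ De / 2) / 2)) <= e / 2.
  rewrite -[leRHS](lnK (_ : _ \is Num.pos)) ?posrE// ler_expR.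
  have : expR (- (2 * ln (e / 2))) <= C * l `^ De / 2.
    by rewrite ler_pdivlMr// -ler_pdivrMl// mulrC.
  move=> h; have : - (2 * ln (e / 2)) <= ln (C * l `^ De / 2).
    by rewrite -ler_expR lnK// posrE (lt_le_trans _ h)// expR_gt0.
  lra.
have kx := key x l1 lc1 lc lC.
have PC := probability_setC P (mE x).
have fE : P (E x) \is a fin_num by exact: fin_num_measure.
rewrite /= -/(E x).
have h1 : fine (P (~` E x)) = 1 - fine (P (E x)).
  by rewrite PC -(fineK fE).
have h2 : fine (P (~` E x)) <= e / 2 + e / 2.
  rewrite -lee_fin fineK; last by apply: fin_num_measure; exact: measurableC.
  by apply: le_trans kx _; rewrite lee_fin; exact: lerD.
have h3 : 0 <= fine (P (~` E x)) by rewrite fine_ge0.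
rewrite -h1 ger0_norm//; lra.
Unshelve. all: by end_near.
Qed.
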